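(* Consider the perturbed federated algorithm described in the context, with $\beta\in(0,1)$, run for $T\ge1$ rounds with constant step size $\gamma=[2L\sqrt{TE}]^{-1}$. Assume that the bounded variance, bounded stochastic gradient norm, $L$-smoothness and lower-bounded objective assumptions of the context hold. Let $\widehat{\mathbf{w}}_T$ be drawn uniformly at random from $\{\overline{\mathbf{w}}_{t,k}:0\le t\le T-1,\,0\le k\le E-1\}$. Then $$\mathbb{E}\|\nabla F(\widehat{\mathbf{w}}_T)\|^2\le\frac1{\sqrt T}\Big[\frac{4L\Delta}{\sqrt E}+\frac{S\sigma^2}{2\sqrt E}\Big]+\frac{EG^2}{T}\Big[4+(1-\beta)^2+8\Big(1-\frac1\beta\Big)^2\Big],$$ where $\Delta=F(\overline{\mathbf{w}}_{0,0})-f_{\inf}$ and $S=\sum_ip_i^2$.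
   Context: Setting: there are $C$ clients with local objectives $F_i:\mathbb{R}^D\to\mathbb{R}$. Similarity weights $p_{in}\ge0$ are symmetric, satisfy $p_{ii}=0$, and $\sum_{i,n}p_{in}=1$. Let $p_i=\sum_np_{in}>0$. The global objective is $F=\sum_ip_iF_i$. Algorithm, with parameter $\beta$, $E\ge1$ local steps and step sizes $\gamma_t$, all clients participating: - $\mathbf{u}^i_0=\overline{\mathbf{w}}_{0,0}$. - In round $t$, each client sets $\mathbf{w}^i_{t,0}=\overline{\mathbf{w}}_{t,0}$. For $k=0,\dots,E-1$ it forms $\widetilde{\mathbf{w}}^i_{t,k}=\beta\mathbf{w}^i_{t,k}+(1-\beta)\mathbf{u}^i_t$ and updates $\mathbf{w}^i_{t,k+1}=\mathbf{w}^i_{t,k}-\gamma_tg_i(\widetilde{\mathbf{w}}^i_{t,k})$, with stochastic gradients $g_i$ of $F_i$ sampled independently across clients and steps given the past. - $\overline{\mathbf{w}}_{t,k}=\sum_ip_i\mathbf{w}^i_{t,k}$ and $\overline{\mathbf{w}}_{t+1,0}=\overline{\mathbf{w}}_{t,E}$. - For $t\ge1$, $\mathbf{u}^i_t=\frac1{p_i}\sum_np_{in}\mathbf{w}^n_{t-1,E}$. $\mathbb{E}$ denotes total expectation. Assumptions: - Bounded variance: $\mathbb{E}\,g_i(\widetilde{\mathbf{w}}^i_{t,k})=\nabla F_i(\widetilde{\mathbf{w}}^i_{t,k})$ and $\mathbb{E}\|g_i(\widetilde{\mathbf{w}}^i_{t,k})-\nabla F_i(\widetilde{\mathbf{w}}^i_{t,k})\|^2\le\sigma^2$.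 - Bounded stochastic gradient norm: $\mathbb{E}\|g_i(\widetilde{\mathbf{w}}^i_{t,k})\|^2\le G^2$. - $L$-smoothness: each $\nabla F_i$ is $L$-Lipschitz. - Lower-bounded objective: $F\ge f_{\inf}$. *)

(* Defs.v *)
From HB Require Import structures.
From mathcomp Require Import all_boot all_order all_algebra.
From mathcomp Require Import all_classical all_reals all_analysis.

Set Implicit Arguments.
Unset Strict Implicit.
Unset Printing Implicit Defensive.
Import Order.TTheory GRing.Theory Num.Theory.
Import numFieldNormedType.Exports.

Local Open Scope classical_set_scope.
Local Open Scope ring_scope.

Definition dotv (R : ringType) (D : nat) (a b : 'rV[R]_D) : R :=
  \sum_(c < D) a ord0 c * b ord0 c.

Definition sqnorm (R : ringType) (D : nat) (a : 'rV[R]_D) : R := dotv a a.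

Definition pw (R : ringType) (C : nat) (p : 'I_C -> 'I_C -> R) (i : 'I_C) : R :=
  \sum_(n < C) p i n.

Definition Fglob (R : ringType) (C D : nat) (p : 'I_C -> 'I_C -> R)
  (F : 'I_C -> 'rV[R]_D -> R) (w : 'rV[R]_D) : R :=
  \sum_(i < C) pw p i * F i w.

Definition gradglob (R : ringType) (C D : nat) (p : 'I_C -> 'I_C -> R)
  (gradF : 'I_C -> 'rV[R]_D -> 'rV[R]_D) (w : 'rV[R]_D) : 'rV[R]_D :=
  \sum_(i < C) pw p i *: gradF i w.

(* ---------- the algorithm (pathwise) ----------
   gs i t k is the stochastic gradient g_i(wtilde^i_{t,k}) drawn by client i at
   local step k of round t (a realization).  All iterates are determined by them. *)

Section Algorithm.
Variables (R : fieldType) (C D : nat) (p : 'I_C -> 'I_C -> R)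
  (beta gamma : R) (E : nat) (w0 : 'rV[R]_D)
  (gs : 'I_C -> nat -> nat -> 'rV[R]_D).

Fixpoint wbar0 (t : nat) : 'rV[R]_D :=
  match t with
  | 0 => w0
  | t'.+1 => \sum_(i < C) pw p i *: (wbar0 t' - gamma *: \sum_(l < E) gs i t' l)
  end.

(* w^i_{t,k}: w^i_{t,0} = wbar_{t,0},  w^i_{t,k+1} = w^i_{t,k} - gamma g_i(wtilde^i_{t,k}) *)
Definition wloc (i : 'I_C) (t k : nat) : 'rV[R]_D :=
  wbar0 t - gamma *: \sum_(l < k) gs i t l.

Definition uvec (i : 'I_C) (t : nat) : 'rV[R]_D :=
  match t with
  | 0 => w0
  | t'.+1 => (pw p i)^-1 *: \sum_(n < C) p i n *: wloc n t' E
  end.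

Definition wtil (i : 'I_C) (t k : nat) : 'rV[R]_D :=
  beta *: wloc i t k + (1 - beta) *: uvec i t.

Definition wbar (t k : nat) : 'rV[R]_D := \sum_(i < C) pw p i *: wloc i t k.

End Algorithm.

Definition lexlt (s l t k : nat) : bool := (s < t)%N || ((s == t) && (l < k)%N).

Section Prob.
Variables (R : realType) (d : measure_display) (Omega : measurableType d).

Definition past (C D : nat) (g : 'I_C -> nat -> nat -> Omega -> 'rV[R]_D)
  (t k : nat) : set (set Omega) :=
  <<s [set A | exists (j : 'I_C) (s l : nat) (c : 'I_D) (B : set R),
        lexlt s l t k /\ measurable B /\
        A = (fun w => g j s l w ord0 c) @^-1` B] >>.

Definition measurable_wrt (G : set (set Omega)) (Y : Omega -> R) : Prop :=
  forall B : set R, measurable B -> G (Y @^-1` B).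

Definition is_cond_exp (P : probability Omega R) (G : set (set Omega))
  (X Y : Omega -> R) : Prop :=
  [/\ measurable_wrt G Y,
      P.-integrable setT (EFin \o X),
      P.-integrable setT (EFin \o Y) &
      forall A, G A -> (\int[P]_(w in A) (X w)%:E = \int[P]_(w in A) (Y w)%:E)%E].

(* the random vectors X_1, ..., X_C are (mutually) conditionally independent
   given G: P(X_i in B_i for all i | G) = prod_i P(X_i in B_i | G) a.s., for all
   measurable boxes B_i (boxes generate the Borel sets of R^D) *)
Definition cond_indep (P : probability Omega R) (G : set (set Omega))
  (C D : nat) (X : 'I_C -> Omega -> 'rV[R]_D) : Prop :=
  forall B : 'I_C -> 'I_D -> set R, (forall i c, measurable (B i c)) ->
  exists (Y : 'I_C -> Omega -> R) (Z : Omega -> R),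
    [/\ forall i, is_cond_exp P G
           (\1_[set w | forall c, B i c (X i w ord0 c)]) (Y i),
        is_cond_exp P G
           (\1_[set w | forall i c, B i c (X i w ord0 c)]) Z &
        {ae P, forall w, Z w = \prod_(i < C) Y i w}].

End Prob.

(* Main.v *)
(* Smoothness gives, for one local step from x = wbar_{t,k} to x' = wbar_{t,k+1},
     E F(x') <= E F(x) - gamma/2 E|grad F(x)|^2 + gamma/2 max_i E|grad F_i(x) - h_i|^2
                + L gamma^2/2 S sigma^2,
   where h_i = grad F_i(wtilde_i) is the conditional mean of g_i, and L gamma <= 1
   disposes of the term in E|sum_i p_i h_i|^2. The drift x - wtilde_i is the convex
   combination beta (x - w_i) + (1 - beta) (x - u_i), and each part is gamma times
   a signed sum of at most three averages of sums of at most E stochastic gradients,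
   whence E|x - wtilde_i|^2 <= 16 gamma^2 E^2 G^2. Telescoping then yields the bound
   with the last bracket replaced by 4.

   The conditional expectations are handled by one principle: if E[W 1{V in B}] = 0
   for every Borel set B then E[W V] = 0 (approximate V by simple functions). Applied
   once, it pulls a measurable factor out of a conditional expectation; applied
   twice, it turns conditional independence on boxes into E[xi_i xi_j] = 0 for the
   noises xi_i = g_i - h_i. *)
Require Import Defs.
From HB Require Import structures.
From mathcomp Require Import all_boot all_order all_algebra.
From mathcomp Require Import ring lra.
From mathcomp Require Import all_classical all_reals all_analysis.
From mathcomp Require Import measurable_realfun.
Import Order.TTheory GRing.Theory Num.Theory.
Import numFieldNormedType.Exports.
Local Open Scope classical_set_scope.
Local Open Scope ring_scope.
Set Implicit Arguments.
Unset Strict Implicit.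

(** * Squared norms *)

Section Vectors.
Context {R : realFieldType} {D : nat}.
Implicit Types a b u : 'rV[R]_D.

Lemma sqnormE a : sqnorm a = \sum_(c < D) a ord0 c ^+ 2.
Proof. by apply: eq_bigr => c _; rewrite expr2. Qed.

Lemma sqnorm_ge0 a : 0 <= sqnorm a.
Proof. by rewrite sqnormE sumr_ge0 // => c _; rewrite sqr_ge0. Qed.

Lemma sqnorm_comp a c : a ord0 c ^+ 2 <= sqnorm a.
Proof.
rewrite sqnormE (bigD1 c) //= lerDl sumr_ge0 // => i _; exact: sqr_ge0.
Qed.

Lemma dotvC a b : dotv a b = dotv b a.
Proof. by apply: eq_bigr => c _; rewrite mulrC. Qed.

Lemma dotvZr x a b : dotv a (x *: b) = x * dotv a b.
Proof. by rewrite mulr_sumr; apply: eq_bigr => c _; rewrite mxE mulrCA. Qed.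

Lemma dotvBl a b u : dotv (a - b) u = dotv a u - dotv b u.
Proof.
by rewrite -sumrB; apply: eq_bigr => c _; rewrite !mxE mulrBl.
Qed.

Lemma dotv_suml I (r : seq I) (f : I -> 'rV[R]_D) b :
  dotv (\sum_(i <- r) f i) b = \sum_(i <- r) dotv (f i) b.
Proof.
rewrite exchange_big /=; apply: eq_bigr => c _.
by rewrite summxE mulr_suml.
Qed.

Lemma sqnormD a b : sqnorm (a + b) = sqnorm a + 2 * dotv a b + sqnorm b.
Proof.
rewrite !sqnormE /dotv mulr_sumr -!big_split; apply: eq_bigr => c _ /=.
by rewrite mxE; ring.
Qed.

Lemma sqnormB a b : sqnorm (a - b) = sqnorm a - 2 * dotv a b + sqnorm b.
Proof.
rewrite !sqnormE /dotv mulr_sumr -sumrB -!big_split; apply: eq_bigr => c _ /=.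
by rewrite !mxE; ring.
Qed.

Lemma sqnormZ x a : sqnorm (x *: a) = x ^+ 2 * sqnorm a.
Proof.
by rewrite !sqnormE mulr_sumr; apply: eq_bigr => c _; rewrite mxE exprMn.
Qed.

(* Sum over all pairs of q_i q_j (x_i - x_j)^2 >= 0. *)
Lemma sqr_wsum_le (I : finType) (q x : I -> R) : (forall i, 0 <= q i) ->
  (\sum_i q i * x i) ^+ 2 <= (\sum_i q i) * \sum_i q i * x i ^+ 2.
Proof.
move=> q0; rewrite -subr_ge0.
suff -> : (\sum_i q i) * (\sum_i q i * x i ^+ 2) - (\sum_i q i * x i) ^+ 2 =
    2^-1 * \sum_i \sum_j q i * q j * (x i - x j) ^+ 2.
  rewrite mulr_ge0 ?invr_ge0 // sumr_ge0 // => i _.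
  by rewrite sumr_ge0 // => j _; rewrite mulr_ge0 ?sqr_ge0 ?mulr_ge0.
have -> : \sum_i \sum_j q i * q j * (x i - x j) ^+ 2 =
   \sum_i \sum_j q i * x i ^+ 2 * q j + \sum_i \sum_j q i * (q j * x j ^+ 2)
   - 2 * \sum_i \sum_j q i * x i * (q j * x j).
  rewrite mulr_sumr -big_split -sumrB; apply: eq_bigr => i _ /=.
  by rewrite mulr_sumr -big_split -sumrB; apply: eq_bigr => j _ /=; ring.
by rewrite -!big_distrlr /=; field.
Qed.

Lemma sqnorm_wsum_le (I : finType) (q : I -> R) (f : I -> 'rV[R]_D) :
  (forall i, 0 <= q i) ->
  sqnorm (\sum_i q i *: f i) <= (\sum_i q i) * \sum_i q i * sqnorm (f i).
Proof.
move=> q0; rewrite sqnormE.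
under [X in _ <= _ * X]eq_bigr do rewrite sqnormE mulr_sumr.
rewrite exchange_big /= mulr_sumr; apply: ler_sum => c _.
rewrite summxE [X in X ^+ 2](eq_bigr (fun i => q i * f i ord0 c)).
  exact: sqr_wsum_le.
by move=> i _; rewrite mxE.
Qed.

Lemma sqnorm_convex (I : finType) (q : I -> R) (f : I -> 'rV[R]_D) :
  (forall i, 0 <= q i) -> \sum_i q i = 1 ->
  sqnorm (\sum_i q i *: f i) <= \sum_i q i * sqnorm (f i).
Proof. by move=> q0 q1; have := sqnorm_wsum_le f q0; rewrite q1 mul1r. Qed.

(** Parallelogram law: the gap between the two sides is [sqnorm (a - b)]. *)
Lemma sqnormD_le a b : sqnorm (a + b) <= 2 * (sqnorm a + sqnorm b).
Proof. by have := sqnorm_ge0 (a - b); rewrite sqnormB sqnormD; lra. Qed.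

End Vectors.

(** * Smooth functions *)

Section Smooth.
Context {R : realType} {D : nat}.
Implicit Types (f : 'rV[R]_D -> R) (df : 'rV[R]_D -> 'rV[R]_D).

(** The difference quotient of the restriction to the line at [s] coincides with that of [f] at
    [w + s *: v] in the direction [v]. *)
Lemma is_derive_line f df (w v : 'rV[R]_D) (s : R) :
  (forall w, differentiable f w /\ forall v, 'd f w v = dotv (df w) v) ->
  is_derive s 1 (fun x => f (w + x *: v)) (dotv (df (w + s *: v)) v).
Proof.
move=> dfE; have [fd fE] := dfE (w + s *: v).
have := @derivableP _ _ _ _ _ _ (@diff_derivable _ _ _ _ _ v fd).
rewrite deriveE // fE => -[].
set q1 := (X in cvg (X @ _) -> _ -> _) => dv dE.
rewrite /derive /= in dE.
have qE : (fun h => h^-1 *: (((fun x : R => f (w + x *: v)) \o shift s) (h *: 1) -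
      f (w + s *: v))) = q1.
  apply/funext => h; rewrite /q1 /=; congr (_ *: (f _ - _)).
  by rewrite /shift /= scalerDl addrCA -[h *: 1]/(h * 1) mulr1.
split; first by rewrite /derivable /= qE.
by rewrite /derive /= qE.
Qed.

Lemma smooth_descent f df (L : R) (w v : 'rV[R]_D) : 0 < L ->
  (forall w, differentiable f w /\ forall v, 'd f w v = dotv (df w) v) ->
  (forall w v, sqnorm (df w - df v) <= L ^+ 2 * sqnorm (w - v)) ->
  f (w + v) <= f w + dotv (df w) v + L / 2 * sqnorm v.
Proof.
move=> L0 dfE lip.
pose phi (s : R) := f (w + s *: v) - (dotv (df w) v * s + L / 2 * sqnorm v * s ^+ 2).
pose dphi (s : R) := dotv (df (w + s *: v)) v - (dotv (df w) v + L * sqnorm v * s).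
have dphiE (s : R) : is_derive s (1 : R) phi (dphi s).
  apply: is_deriveB; first exact: is_derive_line.
  apply: is_derive_eq.
  by rewrite -![_ *: _]/(_ * _); field.
have phic : {within `[0, 1], continuous phi}.
  apply: derivable_within_continuous => x _.
  exact: ex_derive.
have [c c01] := @MVT R phi dphi 0 1 ltr01 (fun x _ => dphiE x) phic.
move: c01; rewrite in_itv /= => /andP[c0 c1] E1.
have dle : dphi c <= 0.
  have := lip (w + c *: v) w; rewrite addrAC subrr add0r sqnormZ => h1.
  (* Expanding this square and bounding the gradient increment by the Lipschitz property gives [dotv
     (df (w + c *: v) - df w) v <= L * c * sqnorm v], after division by [L * c], which is positive
     since [0 < c]. *)
  have := sqnorm_ge0 ((df (w + c *: v) - df w) - (L * c) *: v).
  rewrite [sqnorm (_ - _ *: _)]sqnormB sqnormZ dotvZr dotvBl => h2.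
  have Lc : 0 < L * c by rewrite mulr_gt0.
  rewrite -(pmulr_rle0 _ Lc) /dphi; move: h1 h2.
  set x := sqnorm _; set y := dotv _ _; set z := dotv _ _; set t := sqnorm _.
  by move=> h1 h2; nra.
have : phi 1 - phi 0 <= 0 by rewrite E1 subr0 mulr1.
by rewrite /phi scale1r scale0r addr0 mulr0 expr0n expr1n /= !mulr1 mulr0; lra.
Qed.

Lemma lip_continuous df (L : R) (c : 'I_D) :
  (forall w v, sqnorm (df w - df v) <= L ^+ 2 * sqnorm (w - v)) ->
  continuous (fun w => df w ord0 c).
Proof.
move=> lip w.
apply/(@cvgrPdist_lt _ _ _ (nbhs w) (nbhs_filter w)) => e e0.
(* The neighbourhood below is a sup-norm ball, so [sqnorm (w - u)] is at most [D] times [de ^+ 2].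
   The summand 2 in [K] secures [L ^ 2 D < K <= K ^ 2], which closes the estimate. *)
pose K := L ^+ 2 * D%:R + 2.
have K0 : 0 < K by rewrite ltr_wpDl // mulr_ge0 ?sqr_ge0.
pose de := e / K.
have de0 : 0 < de by rewrite divr_gt0.
have hb : \forall u \near w, ball w de u by exact: nbhsx_ballx.
near=> u.
have wu : ball w de u by near: u.
have hu i : `|(w - u) ord0 i| < de by rewrite !mxE; have := wu.2 ord0 i.
rewrite -(@ltr_pXn2r _ 2) ?nnegrE ?normr_ge0 ?(ltW e0) // real_normK ?num_real //.
have -> : df w ord0 c - df u ord0 c = (df w - df u) ord0 c by rewrite !mxE.
apply: le_lt_trans (sqnorm_comp _ _) _.
apply: le_lt_trans (lip _ _) _.
have h : sqnorm (w - u) <= D%:R * de ^+ 2.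
  rewrite sqnormE -[X in X%:R * _](card_ord D) mulr_natl -sumr_const.
  apply: ler_sum => i _; rewrite -(real_normK (num_real _)).
  by rewrite ler_pXn2r ?nnegrE ?normr_ge0 ?(ltW de0) // ltW.
apply: le_lt_trans (ler_wpM2l (sqr_ge0 L) h) _.
rewrite mulrA /de expr_div_n mulrA ltr_pdivrMr ?exprn_gt0 // mulrC.
rewrite ltr_pM2l ?exprn_gt0 // (@lt_le_trans _ _ K) ?ltrDl // expr2 ler_peMl ?ltW //.
have : 0 <= L ^+ 2 * D%:R by rewrite mulr_ge0 ?sqr_ge0.
by rewrite /K; lra.
Unshelve. all: by end_near. Qed.

(* The sup-norm balls with rational centre and radius 1/(n+1) form a countable
   base, and the preimage of each is a finite intersection of measurable sets. *)
Lemma measurable_fun_continuous_rV d (T : measurableType d)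
  (X : T -> 'rV[R]_D) (f : 'rV[R]_D -> R) :
  (forall c, measurable_fun setT (fun w => X w ord0 c)) -> continuous f ->
  measurable_fun setT (fun w => f (X w)).
Proof.
move=> mX cf.
apply: (measurability _ (RGenOInfty.measurableE R)) => //.
move=> _ [_ [y ->] <-]; rewrite setTI.
pose U := [set x : 'rV[R]_D | y < f x].
have Uo : open U.
  have -> : U = f @^-1` `]y, +oo[ by apply/seteqP; split => x /=; rewrite in_itv /= andbT.
  by apply: open_comp => //.
pose Q (q : 'rV[rat]_D) : 'rV[R]_D := map_mx ratr q.
pose J (qn : 'rV[rat]_D * nat) : set T :=
  [set w | ball (Q qn.1) qn.2.+1%:R^-1 `<=` U /\
    forall c, ball (Q qn.1 ord0 c) qn.2.+1%:R^-1 (X w ord0 c)].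
have -> : (fun w => f (X w)) @^-1` `]y, +oo[ = \bigcup_qn J qn.
  apply/seteqP; split => w /=.
    rewrite in_itv /= andbT => fw.
    have [e /= e0 eU] : nbhs_ball (X w) U.
      by apply/nbhs_ballP; apply: open_nbhs_nbhs; split.
    (* This makes the radius smaller than [e / 2]: a ball of that radius whose centre is equally
       close to [X w] lies in the [e]-ball around [X w], hence in [U]. *)
    pose n := Num.truncn (2 / e).
    have ne : n.+1%:R^-1 < e / 2.
      rewrite -[e / 2]invrK ltf_pV2 ?posrE ?invr_gt0 ?divr_gt0 // invf_div.
      exact: truncnS_gt.
    have n0 : 0 < n.+1%:R^-1 :> R by rewrite invr_gt0.
    have qx (c : 'I_D) : exists q : rat, `|X w ord0 c - ratr q| < n.+1%:R^-1.
      have [q] := @rat_in_itvoo R (X w ord0 c - n.+1%:R^-1) (X w ord0 c + n.+1%:R^-1)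
         ltac:(by rewrite ltrD2l gtrN).
      rewrite in_itv /= => /andP[q1 q2]; exists q.
      by rewrite distrC ltr_distl q1 q2.
    pose q : 'rV[rat]_D := \row_c projT1 (cid (qx c)).
    have qX c : ball (Q q ord0 c) n.+1%:R^-1 (X w ord0 c).
      rewrite /ball /= !mxE distrC; exact: projT2 (cid (qx c)).
    exists (q, n) => //; split => //= z [_ Qz]; apply: eU.
    split=> // i c; rewrite (ord1 i).
    rewrite [e]splitr; apply: (@ball_triangle _ _ (Q q ord0 c)).
      by apply: (le_ball (ltW ne)); apply: ball_sym.
    by apply: (le_ball (ltW ne)); exact: Qz.
  move=> [[q n] _ [/= qU qX]]; rewrite in_itv /= andbT; apply: qU.
  by split=> [|i c]; rewrite ?invr_gt0 // (ord1 i).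
apply: countable_bigcupT_measurable; first exact: countableP.
move=> [q n]; rewrite /J /=.
have [h|h] := pselect (ball (Q q) n.+1%:R^-1 `<=` U); last first.
  rewrite (_ : [set _ | _] = set0); first exact: measurable0.
  by apply/seteqP; split => // w [].
rewrite (_ : [set _ | _] = \bigcap_(c in [set: 'I_D])
    ((fun w => X w ord0 c) @^-1` ball (Q q ord0 c) n.+1%:R^-1)); last first.
  by apply/seteqP; split => [w [_ qX] c _|w qX]; [exact: qX|split=> // c; exact: qX].
apply: fin_bigcap_measurable => [|c _]; first exact: finite_finset.
by rewrite -[X in measurable X]setTI; apply: mX => //; exact: measurable_ball.
Qed.

End Smooth.

(** * Expectations *)

Section Expectation.
Import HBNNSimple.
Context {R : realType} {d : measure_display} {Omega : measurableType d}.
Variable P : probability Omega R.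
Implicit Types f g W V X Y : Omega -> R.

Definition rint f := P.-integrable setT (EFin \o f).

(** Measurability is required separately, since integrability of the square only makes the square
    measurable. *)
Definition sqint X := measurable_fun setT X /\ rint (fun w => X w ^+ 2).

Lemma rint_meas f : rint f -> measurable_fun setT f.
Proof. by move=> /(measurable_int P)/measurable_EFinP. Qed.

Lemma rint_le g f : measurable_fun setT f -> (forall w, `|f w| <= g w) ->
  rint g -> rint f.
Proof.
move=> mf fg; apply: le_integrable => //; first exact/measurable_EFinP.
by move=> w _; rewrite /= lee_fin (le_trans (fg w)) // ler_norm.
Qed.

Lemma rintD f g : rint f -> rint g -> rint (fun w => f w + g w).
Proof. exact: integrableD. Qed.

Lemma rintZ x f : rint f -> rint (fun w => x * f w).
Proof. exact: integrableZl. Qed.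

Lemma rintB f g : rint f -> rint g -> rint (fun w => f w - g w).
Proof. exact: integrableB. Qed.

Lemma rint_cst x : rint (fun=> x).
Proof. exact: finite_measure_integrable_cst. Qed.

Lemma rint_sum I (r : seq I) (f : I -> Omega -> R) :
  (forall i, rint (f i)) -> rint (fun w => \sum_(i <- r) f i w).
Proof.
move=> fi; elim: r => [|i r ih].
  by under [fun w => _]eq_fun do rewrite big_nil; exact: rint_cst.
under [fun w => _]eq_fun do rewrite big_cons.
exact: rintD.
Qed.

Lemma rint_mulb f g : rint f -> measurable_fun setT g ->
  (forall w, `|g w| <= 1) -> rint (fun w => f w * g w).
Proof.
move=> fi mg g1; apply: (@rint_le (fun w => `|f w|)).
- by apply: measurable_funM => //; exact: rint_meas.
- by move=> w; rewrite normrM ler_piMr.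
- exact: integrable_norm.
Qed.

Lemma rint_mul_indic f (A : set Omega) : rint f -> measurable A ->
  rint (fun w => f w * \1_A w).
Proof.
move=> fi mA; apply: rint_mulb => // w.
by rewrite indicE; case: (_ \in _); rewrite ?normr0 ?normr1.
Qed.

Lemma Rintegral_sum I (r : seq I) (f : I -> Omega -> R) :
  (forall i, rint (f i)) ->
  \int[P]_w (\sum_(i <- r) f i w) = \sum_(i <- r) \int[P]_w f i w.
Proof.
move=> fi; elim: r => [|i r ih].
  under eq_Rintegral do rewrite big_nil.
  by rewrite big_nil Rintegral_cst // mul0r.
under eq_Rintegral do rewrite big_cons.
by rewrite big_cons RintegralD //; [rewrite ih | exact: fi | exact: rint_sum].
Qed.

Lemma EFin_Rintegral f : rint f ->
  ((\int[P]_w f w)%:E = \int[P]_w (f w)%:E)%E.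
Proof. by move=> fi; rewrite /Rintegral fineK //; exact: integrable_fin_num. Qed.

Lemma Rintegral_probability_cst x : \int[P]_w x = x.
Proof. by rewrite Rintegral_cst //= probability_setT mulr1. Qed.

Lemma Rintegral_indic_in f (A : set Omega) :
  \int[P]_(w in A) f w = \int[P]_w (f w * \1_A w).
Proof.
rewrite Rintegral_mkcond; apply: eq_Rintegral => w _.
by rewrite patchE indicE; case: (w \in A); rewrite ?mulr1 ?mulr0.
Qed.

(** The product is dominated by the sum of the squares. *)
Lemma sqint_mul X Y : sqint X -> sqint Y -> rint (fun w => X w * Y w).
Proof.
move=> [mX iX] [mY iY].
apply: (rint_le _ _ (rintD iX iY)); first exact: measurable_funM.
move=> w; rewrite normrM -(real_normK (num_real (X w))) -(real_normK (num_real (Y w))).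
have := sqr_ge0 (`|X w| - `|Y w|); have := sqr_ge0 (`|X w| + `|Y w|).
by set x := `|X w|; set y := `|Y w|; nra.
Qed.

(** Domination by [X ^ 2 + 1], where the constant is integrable because [P] is finite. *)
Lemma sqint_int X : sqint X -> rint X.
Proof.
move=> [mX iX]; apply: (rint_le mX _ (rintD iX (rint_cst 1))) => w.
rewrite -(real_normK (num_real (X w))).
by have := sqr_ge0 (`|X w| - 1); set x := `|X w|; nra.
Qed.

Lemma sqint_cst x : sqint (fun=> x).
Proof. by split; [exact: measurable_cst | exact: rint_cst]. Qed.

Lemma sqintD X Y : sqint X -> sqint Y -> sqint (fun w => X w + Y w).
Proof.
move=> hX hY; have [mX iX] := hX; have [mY iY] := hY.
split; first exact: measurable_funD.
have := rintD (rintD iX (rintZ 2 (sqint_mul hX hY))) iY.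
by congr rint; apply/funext => w; ring.
Qed.

Lemma sqintZ x X : sqint X -> sqint (fun w => x * X w).
Proof.
move=> [mX iX]; split; first exact: measurable_funM.
by have := rintZ (x ^+ 2) iX; congr rint; apply/funext => w; rewrite exprMn.
Qed.

Lemma sqintB X Y : sqint X -> sqint Y -> sqint (fun w => X w - Y w).
Proof.
move=> hX /(sqintZ (-1)) /(sqintD hX); congr sqint.
by apply/funext => w; rewrite mulN1r.
Qed.

Lemma sqint_sum I (r : seq I) (f : I -> Omega -> R) :
  (forall i, sqint (f i)) -> sqint (fun w => \sum_(i <- r) f i w).
Proof.
move=> fi; elim: r => [|i r ih].
  by under [fun w => _]eq_fun do rewrite big_nil; exact: sqint_cst.
under [fun w => _]eq_fun do rewrite big_cons.
exact: sqintD.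
Qed.

(** The approximating simple functions are taken on the real line and composed with [V], so that
    their level sets have the form [V @^-1] followed by a Borel set, to which the hypothesis
    applies. The limit is by dominated convergence with bound [|W V|]. *)
Let Rintegral_mul_comp0_ge0 W V : rint W -> measurable_fun setT V ->
  rint (fun w => W w * V w) -> (forall w, 0 <= V w) ->
  (forall B, measurable B -> \int[P]_w (W w * \1_(V @^-1` B) w) = 0) ->
  \int[P]_w (W w * V w) = 0.
Proof.
move=> iW mV iWV V0 h0.
(* Approximation from below needs a function that is nonnegative on the whole line; [max x 0] is
   one, and it is the identity on the values of [V]. *)
have mh : measurable_fun setT (fun x : R => (Num.max x 0)%:E).
  by apply/measurable_EFinP; exact: measurable_maxr.
have [g [ndg gh]] := approximation (@measurableT _ R) mh
  (fun x _ => ltac:(by rewrite lee_fin le_max lexx orbT)).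
have gV w : g ^~ (V w) @ \oo --> V w.
  have := gh (V w) I; rewrite (max_idPl (V0 w)) => /fine_cvgP[_].
  exact.
have gle n w : g n (V w) <= V w.
  rewrite -[leRHS](cvg_lim (@Rhausdorff R) (gV w)).
  apply: (nondecreasing_cvgn_le (u_ := g ^~ (V w))).
    by move=> a b ab; have /lefP := ndg _ _ ab; exact.
  by apply/cvg_ex; exists (V w).
have mgV n : measurable_fun setT (fun w => g n (V w)).
  by apply: measurableT_comp => //.
have in0 n : \int[P]_w (W w * g n (V w)) = 0.
  under eq_Rintegral => w _.
    rewrite (fimfunE (g n)) fsbig_finite //= mulr_sumr.
    under eq_bigr => y _ do rewrite mulrCA.
    over.
  have iW1 y : rint (fun w => W w * \1_(g n @^-1` [set y]) (V w)).
    apply: (@rint_mul_indic W (V @^-1` (g n @^-1` [set y]))) => //.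
    by rewrite -[X in measurable X]setTI; exact: mV.
  rewrite Rintegral_sum; last by move=> y; exact: rintZ.
  rewrite big1 // => y _; rewrite RintegralZl //; last exact: iW1.
  by rewrite (h0 (g n @^-1` [set y])) ?mulr0.
have [|||||_ _] := @dominated_convergence _ _ _ P setT measurableT
  (fun n w => (W w * g n (V w))%:E) (fun w => (W w * V w)%:E)
  (fun w => `|W w * V w|%:E).
- move=> n; apply/measurable_EFinP/measurable_funM => //; exact: rint_meas.
- exact/measurable_EFinP/rint_meas.
- apply: aeW => w _; apply: cvg_EFin.
    by near=> n.
  by apply: cvgM; [exact: cvg_cst | exact: gV].
- exact: integrable_norm.
- apply: aeW => w n _; rewrite /= lee_fin !normrM ler_wpM2l //.
  by rewrite !ger0_norm.
rewrite (_ : (fun n => _) = fun=> 0%:E); last first.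
  apply/funext => n; rewrite -EFin_Rintegral ?in0 //.
  apply: (@rint_le (fun w => `|W w * V w|)); last exact: integrable_norm.
    by apply: measurable_funM => //; exact: rint_meas.
  by move=> w; rewrite !normrM ler_wpM2l // !ger0_norm.
move=> /(cvg_lim (@ereal_hausdorff R)); rewrite lim_cst; last exact: ereal_hausdorff.
by rewrite -EFin_Rintegral // => -[].
Unshelve. all: by end_near. Qed.

(** Positive and negative parts of [V], obtained as [max (s V) 0] for [s = 1] and [s = -1]; events
    about either part are again events [V] in a Borel set. *)
Lemma Rintegral_mul_comp0 W V : rint W -> measurable_fun setT V ->
  rint (fun w => W w * V w) ->
  (forall B, measurable B -> \int[P]_w (W w * \1_(V @^-1` B) w) = 0) ->
  \int[P]_w (W w * V w) = 0.
Proof.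
move=> iW mV iWV h0.
have part (s : R) : `|s| = 1 ->
    rint (fun w => W w * Num.max (s * V w) 0) /\
    \int[P]_w (W w * Num.max (s * V w) 0) = 0.
  move=> s1.
  have mm : measurable_fun setT (fun x : R => Num.max (s * x) 0).
    by apply: measurable_maxr => //; exact: measurable_funM.
  have mVs : measurable_fun setT (fun w => Num.max (s * V w) 0).
    exact: (measurableT_comp mm mV).
  have iWs : rint (fun w => W w * Num.max (s * V w) 0).
    apply: (@rint_le (fun w => `|W w * V w|)); last exact: integrable_norm.
      by apply: measurable_funM => //; exact: rint_meas.
    move=> w; rewrite !normrM ler_wpM2l // -[leRHS]mul1r -s1 -normrM.
    by rewrite maxEle; case: ifP => //; rewrite normr0.
  split=> //; apply: Rintegral_mul_comp0_ge0 => //.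
    by move=> w; rewrite le_max lexx orbT.
  move=> B mB; apply: (h0 ((fun x => Num.max (s * x) 0) @^-1` B)).
  by rewrite -[X in measurable X]setTI; exact: mm.
have [i1 e1] := part 1 (normr1 _).
have [i2 e2] := part (-1) ltac:(by rewrite normrN normr1).
have -> : (fun w => W w * V w) = (fun w =>
    W w * Num.max (1 * V w) 0 - W w * Num.max (-1 * V w) 0).
  apply/funext => w; rewrite -mulrBr mul1r mulN1r; congr (_ * _).
  have [v0|v0] := leP 0 (V w).
    by rewrite (max_idPr _) ?subr0 // oppr_le0.
  by rewrite (max_idPl _) ?sub0r ?opprK // oppr_ge0 ltW.
by rewrite RintegralB // e1 e2 subr0.
Qed.

End Expectation.

(** * Conditional expectations *)

Section CondExp.
Context {R : realType} {d : measure_display} {Omega : measurableType d}.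
Variables (P : probability Omega R) (H : set (set Omega)).
Hypothesis HT : H setT.
Hypothesis HM : H `<=` d.-measurable.
Implicit Types (f g W V X Y Z m n : Omega -> R) (A B : set Omega).
Local Notation rint := (rint P).
Local Notation sqint := (sqint P).

Lemma measurable_wrt_fun Y : measurable_wrt H Y -> measurable_fun setT Y.
Proof. by move=> HY _ B mB; rewrite setTI; apply: HM; exact: HY. Qed.

Lemma measurable_wrt_comp Y (h : R -> R) : measurable_fun setT h ->
  measurable_wrt H Y -> measurable_wrt H (fun w => h (Y w)).
Proof.
move=> mh HY B mB; apply: (HY (h @^-1` B)).
by rewrite -[X in measurable X]setTI; exact: mh.
Qed.

Lemma cond_exp_indic X m A : is_cond_exp P H X m -> H A ->
  \int[P]_w (X w * \1_A w) = \int[P]_w (m w * \1_A w).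
Proof.
move=> [_ _ _ Xm] HA; rewrite -!Rintegral_indic_in.
by congr fine; exact: Xm.
Qed.

(** [X - m] integrates to zero over every event [V] in [B], since such an event belongs to [H];
    [Rintegral_mul_comp0] then extends this from indicators to [V], bounded or not. *)
Lemma cond_exp_pull X m V : is_cond_exp P H X m -> measurable_wrt H V ->
  rint (fun w => X w * V w) -> rint (fun w => m w * V w) ->
  \int[P]_w (X w * V w) = \int[P]_w (m w * V w).
Proof.
move=> Xm HV iXV imV; have [_ iX im _] := Xm.
apply/eqP; rewrite -subr_eq0 -RintegralB //; apply/eqP.
under eq_Rintegral do rewrite -mulrBl.
have mV := measurable_wrt_fun HV.
apply: (@Rintegral_mul_comp0 _ _ _ P (fun w => X w - m w)) => //.
- exact: rintB.
- by under [fun w => _]eq_fun do rewrite mulrBl; exact: rintB.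
move=> B mB; have HB := HV _ mB.
under eq_Rintegral do rewrite mulrBl.
rewrite RintegralB //; try by apply: rint_mul_indic => //; exact: HM.
by rewrite (cond_exp_indic Xm HB) subrr.
Qed.

(** Test with [A], the event that [W] is negative: there [W * \1_A] is nonpositive with nonnegative
    integral, hence zero almost everywhere. *)
Lemma ae_ge0_cond W : rint W -> measurable_wrt H W ->
  (forall A, H A -> 0 <= \int[P]_w (W w * \1_A w)) ->
  {ae P, forall w, 0 <= W w}.
Proof.
move=> iW HW W0.
pose A := W @^-1` `]-oo, 0[.
have HA : H A by exact: HW.
have mA := HM HA.
have iWA := rint_mul_indic iW mA.
have WA w : W w * \1_A w <= 0.
  rewrite indicE; case: (boolP (w \in A)) => [|_]; rewrite ?mulr0 ?mulr1 //.
  by rewrite inE /A /= in_itv /= => /ltW.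
have : (\int[P]_w `|(W w * \1_A w)%:E| = 0)%E.
  transitivity ((\int[P]_w (-1 * (W w * \1_A w)))%:E).
    rewrite EFin_Rintegral; last exact: rintZ.
    by apply: eq_integral => w _; rewrite mulN1r /= ler0_norm.
  congr EFin; apply/eqP; rewrite eq_le; apply/andP; split.
    by rewrite RintegralZl // mulN1r oppr_le0 W0.
  by apply: Rintegral_ge0 => w _; rewrite mulN1r oppr_ge0.
move/(ae_eq_integral_abs P measurableT (measurable_int _ iWA)).
apply: filterS => w /(_ I) /= []; rewrite indicE.
have [wA|] := boolP (w \in A).
  by rewrite mulr1 => ->.
by rewrite notin_setE /A /= in_itv /= => /negP; rewrite -leNgt.
Qed.

Lemma cond_exp_indic_ae01 (A : set Omega) Y : measurable A ->
  is_cond_exp P H (\1_A) Y -> {ae P, forall w, 0 <= Y w <= 1}.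
Proof.
move=> mA AY; have [HY iA iY _] := AY.
have h0 : {ae P, forall w, 0 <= Y w}.
  apply: ae_ge0_cond => // B HB; rewrite -(cond_exp_indic AY HB).
  by apply: Rintegral_ge0 => w _; rewrite mulr_ge0 // indicE.
have h1 : {ae P, forall w, 0 <= 1 - Y w}.
  apply: ae_ge0_cond.
  - by apply: rintB => //; exact: rint_cst.
  - apply: (@measurable_wrt_comp Y (fun x => 1 - x)) => //.
    exact: measurable_funB.
  move=> B HB; have mB := HM HB.
  under eq_Rintegral do rewrite mulrBl.
  rewrite RintegralB //; try by apply: rint_mul_indic => //; exact: rint_cst.
  rewrite -(cond_exp_indic AY HB) subr_ge0; apply: le_Rintegral => //.
  - exact: rint_mul_indic.
  - by apply: rint_mul_indic => //; exact: rint_cst.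
  - by move=> w _; rewrite ler_wpM2r // indicE; case: (_ \in _).
apply: filterS2 h0 h1 => w a b.
by rewrite a -subr_ge0.
Qed.

(** Serves to discard, in a product of conditional probabilities, the factors of clients on which
    the box imposes no constraint. *)
Lemma cond_exp_setT_ae1 Y : is_cond_exp P H (\1_setT) Y ->
  {ae P, forall w, Y w = 1}.
Proof.
move=> TY; have [HY _ iY _] := TY.
have h1 : {ae P, forall w, 0 <= Y w - 1}.
  apply: ae_ge0_cond.
  - by apply: rintB => //; exact: rint_cst.
  - apply: (@measurable_wrt_comp Y (fun x => x - 1)) => //.
    exact: measurable_funB.
  move=> B HB; have mB := HM HB.
  under eq_Rintegral do rewrite mulrBl.
  rewrite RintegralB //; try by apply: rint_mul_indic => //; exact: rint_cst.
  rewrite -(cond_exp_indic TY HB) -RintegralB //; last first.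
  - by apply: rint_mul_indic => //; exact: rint_cst.
  - by apply: rint_mul_indic => //; have [] := TY.
  by apply: Rintegral_ge0 => w _; rewrite indicT /= subrr.
apply: filterS2 h1 (cond_exp_indic_ae01 measurableT TY) => w a /andP[_ b].
by apply/eqP; rewrite eq_le b -subr_ge0.
Qed.

(** Clamping to the unit interval changes [Y] only on a null set and gives pointwise bounds, so that
    products with integrable functions stay integrable. *)
Lemma cond_exp_indic_clamp (A : set Omega) Y : measurable A ->
  is_cond_exp P H (\1_A) Y ->
  exists Y', [/\ is_cond_exp P H (\1_A) Y', forall w, 0 <= Y' w <= 1 &
    {ae P, forall w, Y' w = Y w}].
Proof.
move=> mA AY; have [HY iA iY e] := AY.
pose h (x : R) : R := Num.max 0 (Num.min x 1).
have mh : measurable_fun setT h.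
  by apply: measurable_maxr => //; exact: measurable_minr.
have h01 x : 0 <= h x <= 1.
  by rewrite /h le_max lexx /= ge_max ler01 ge_min lexx orbT.
have HY' : measurable_wrt H (fun w => h (Y w)) by exact: measurable_wrt_comp.
have mY' := measurable_wrt_fun HY'.
have ae : {ae P, forall w, h (Y w) = Y w}.
  apply: filterS (cond_exp_indic_ae01 mA AY) => w /andP[a b].
  by rewrite /h (min_idPl b) (max_idPr a).
exists (fun w => h (Y w)); split=> //; split=> //.
- apply: (@rint_le _ _ _ P (fun=> 1)) => //; last exact: rint_cst.
  by move=> w; have /andP[a b] := h01 (Y w); rewrite ger0_norm.
- move=> B HB; rewrite e //.
  apply: ae_eq_integral => //.
  + exact: HM.
  + by apply/measurable_EFinP/measurable_funTS; exact: rint_meas iY.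
  + by apply/measurable_EFinP/measurable_funTS.
  + by apply: filterS ae => w /= -> _.
Qed.

(* Conditional independence enters only through this consequence: expectations
   of products of indicators factor through bounded conditional expectations. *)
Definition cond_uncorrelated U V := forall A B : set R,
  measurable A -> measurable B -> exists Y Z,
  [/\ is_cond_exp P H (\1_(U @^-1` A)) Y, is_cond_exp P H (\1_(V @^-1` B)) Z,
      forall w, 0 <= Y w <= 1, forall w, 0 <= Z w <= 1 &
      \int[P]_w (\1_(U @^-1` A) w * \1_(V @^-1` B) w) = \int[P]_w (Y w * Z w)].

(** The indicator principle is used twice. With [A] fixed, letting [B] vary gives
    [E[(1{U in A} - Y) V] = 0], which becomes [E[(V - n) 1{U in A}] = 0] by moving conditional
    expectations across; then letting [A] vary gives [E[(V - n) U] = 0]. Finally [E[(V - n) m] = 0]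
    because [m] is measurable with respect to [H]. *)
Lemma cond_uncorrelated_mul0 U V m n : cond_uncorrelated U V ->
  sqint U -> sqint V -> sqint m -> sqint n ->
  is_cond_exp P H U m -> is_cond_exp P H V n ->
  \int[P]_w ((U w - m w) * (V w - n w)) = 0.
Proof.
move=> UV sU sV sm sn Um Vn.
have [Hm iU im _] := Um; have [Hn iV in_ _] := Vn.
have mU := rint_meas iU; have mV := rint_meas iV; have mn := rint_meas in_.
have pre (X : Omega -> R) (B : set R) : measurable_fun setT X -> measurable B ->
    measurable (X @^-1` B).
  by move=> mX mB; rewrite -[X in measurable X]setTI; exact: mX.
have b1 (Y : Omega -> R) : (forall w, 0 <= Y w <= 1) -> forall w, `|Y w| <= 1.
  by move=> Y01 w; have /andP[a b] := Y01 w; rewrite ger0_norm.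
have i01 B w : `|(\1_B w : R)| <= 1.
  by rewrite indicE; case: (_ \in _); rewrite ?normr0 ?normr1.
have key (A : set R) : measurable A -> \int[P]_w ((V w - n w) * \1_(U @^-1` A) w) = 0.
  move=> mA; have mUA := pre _ _ mU mA.
  (* Taking [B = setT] here fixes one version [Y] of the conditional probability of [U] in [A]
     before [B] varies. *)
  have [Y [_ [AY _ Y01 _ _]]] := UV A setT mA measurableT.
  have [HY iA iY _] := AY; have mY := rint_meas iY.
  have iVY := rint_mulb iV mY (b1 _ Y01).
  have iVA := rint_mul_indic iV mUA.
  have inY := rint_mulb in_ mY (b1 _ Y01).
  have inA := rint_mul_indic in_ mUA.
  have e1 : \int[P]_w ((\1_(U @^-1` A) w - Y w) * V w) = 0.
    apply: Rintegral_mul_comp0 => //; first exact: rintB.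
      have := rintB iVA iVY; congr rint; apply/funext => w.
      by rewrite mulrBl ![V w * _]mulrC.
    move=> B mB; have mVB := pre _ _ mV mB.
    under eq_Rintegral do rewrite mulrBl.
    rewrite RintegralB //; [|exact: rint_mul_indic..].
    (* The version [Y'] obtained for this [B] may differ from [Y]; the two are exchanged against [Z]
       by passing through the indicator of [U] in [A], of which both are conditional
       expectations. *)
    have [Y' [Z [AY' BZ Y'01 Z01 ->]]] := UV A B mA mB.
    have [HZ iB iZ _] := BZ; have [_ _ iY' _] := AY'.
    have mZ := rint_meas iZ.
    have iP X X' : rint X -> rint X' -> (forall w, `|X' w| <= 1) ->
      rint (fun w => X w * X' w).
      by move=> iX iX' bX'; apply: (rint_mulb iX) => //; exact: rint_meas iX'.
    rewrite -(cond_exp_pull AY' HZ) //; try by apply: iP => //; exact: b1.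
    rewrite (cond_exp_pull AY HZ) //; try by apply: iP => //; exact: b1.
    under eq_Rintegral do rewrite mulrC.
    rewrite -(cond_exp_pull BZ HY) //; try by apply: iP => //; exact: b1.
    under eq_Rintegral do rewrite mulrC.
    by rewrite subrr.
  move: e1; under eq_Rintegral do rewrite mulrBl ![_ * V _]mulrC.
  rewrite RintegralB // (cond_exp_pull Vn HY) //.
  under [X in _ - X = _ -> _]eq_Rintegral do rewrite mulrC.
  rewrite -(cond_exp_pull AY Hn).
  - under [X in _ - X = _ -> _]eq_Rintegral do rewrite mulrC.
    rewrite -RintegralB // => e1.
    by under eq_Rintegral do rewrite mulrBl.
  - by have := inA; congr rint; apply/funext => w; rewrite mulrC.
  - by have := inY; congr rint; apply/funext => w; rewrite mulrC.
have sVn := sqintB sV sn.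
have i1 := sqint_mul sVn sU; have i2 := sqint_mul sVn sm.
have e1 : \int[P]_w ((V w - n w) * U w) = 0.
  by apply: Rintegral_mul_comp0 => //; exact: sqint_int.
have e2 : \int[P]_w ((V w - n w) * m w) = 0.
  under eq_Rintegral do rewrite mulrBl.
  rewrite RintegralB ?(cond_exp_pull Vn Hm) ?subrr //; exact: sqint_mul.
under eq_Rintegral do rewrite mulrC mulrBr.
by rewrite RintegralB // e1 e2 subrr.
Qed.

(** The box constrains only coordinate [c] of clients [i] and [j]. All other factors are almost
    surely 1, so the conditional probability of the joint event is the product of two, and
    integrating it over the whole space gives the claim. *)
Lemma cond_indep_uncorrelated C D (X : 'I_C -> Omega -> 'rV[R]_D) i j c :
  (forall k c, measurable_fun setT (fun w => X k w ord0 c)) ->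
  cond_indep P H X -> i != j ->
  cond_uncorrelated (fun w => X i w ord0 c) (fun w => X j w ord0 c).
Proof.
move=> mX ci ij A B mA mB.
pose box (k : 'I_C) (c' : 'I_D) : set R :=
  if c' == c then if k == i then A else if k == j then B else setT else setT.
have mbox k c' : measurable (box k c').
  by rewrite /box; do ![case: ifP => _ //].
have pre k (S : set R) : measurable S -> measurable ((fun w => X k w ord0 c) @^-1` S).
  by move=> mS; rewrite -[X in measurable X]setTI; exact: mX.
have [Y [Z [Yc Zc Zae]]] := ci box mbox.
have slice k (S : set R) : box k c = S ->
    [set w | forall c', box k c' (X k w ord0 c')] = (fun w => X k w ord0 c) @^-1` S.
  move=> <-; apply/seteqP; split => w /=; first exact.
  move=> h c'; have [->//|/negbTE c'c] := eqVneq c' c.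
  by rewrite /box c'c.
have bi : box i c = A by rewrite /box !eqxx.
have bj : box j c = B by rewrite /box eqxx eq_sym (negbTE ij) eqxx.
have Yi := Yc i; rewrite (slice _ _ bi) in Yi.
have Yj := Yc j; rewrite (slice _ _ bj) in Yj.
have Y1 k : k != i -> k != j -> {ae P, forall w, Y k w = 1}.
  move=> ki kj; have := Yc k; rewrite (slice _ setT) ?preimage_setT.
    exact: cond_exp_setT_ae1.
  by rewrite /box eqxx (negbTE ki) (negbTE kj).
have [Yi' [ci' b01i aei]] := cond_exp_indic_clamp (pre _ _ mA) Yi.
have [Yj' [cj' b01j aej]] := cond_exp_indic_clamp (pre _ _ mB) Yj.
exists Yi', Yj'; split => //.
have inter : [set w | forall k c', box k c' (X k w ord0 c')] =
    (fun w => X i w ord0 c) @^-1` A `&` (fun w => X j w ord0 c) @^-1` B.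
  apply/seteqP; split => w /=.
    by move=> h; rewrite -bi -bj; split; exact: h.
  move=> [wA wB] k c'; rewrite /box.
  case: eqP => // ->; case: eqP => [->//|_]; by case: eqP => [->|].
have [_ iZ1 iZ _] := Zc.
have -> : \int[P]_w (\1_((fun w => X i w ord0 c) @^-1` A) w *
     \1_((fun w => X j w ord0 c) @^-1` B) w) = \int[P]_w (Z w).
  have := cond_exp_indic Zc HT; rewrite inter.
  under eq_Rintegral do rewrite indicT mulr1.
  under [X in _ = X -> _]eq_Rintegral do rewrite indicT mulr1.
  by move=> <-; apply: eq_Rintegral => w _; rewrite indicI.
have [_ _ iYi _] := ci'; have [_ _ iYj _] := cj'.
congr fine; apply: ae_eq_integral => //.
- exact/measurable_EFinP/(rint_meas iZ).
- apply/measurable_EFinP/measurable_funM; [exact: rint_meas iYi|exact: rint_meas iYj].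
(* There are finitely many clients, so the exceptional null sets can be merged into one. *)
have Yall : {ae P, forall w, forall k, k != i -> k != j -> Y k w = 1}.
  apply: filter_forall => k.
  have [->|ki] := eqVneq k i; first by apply: aeW.
  have [->|kj] := eqVneq k j; first by apply: aeW.
  by apply: filterS (Y1 k ki kj) => w ->.
apply: filterS3 Zae (filterI aei aej) Yall => w /= Zw [wi wj] wk _.
rewrite Zw wi wj; congr EFin; rewrite (bigD1 i) //= (bigD1 j) 1?eq_sym //=.
by rewrite big1 ?mulr1 // => k /andP[ki kj]; exact: wk.
Qed.

End CondExp.

(** * Iterates of the algorithm *)

Section Iterates.
Context {R : fieldType} {C D : nat}.
Variables (p : 'I_C -> 'I_C -> R) (beta gamma : R) (E : nat) (w0 : 'rV[R]_D).
Hypothesis p1 : \sum_i pw p i = 1.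
Implicit Type gs : 'I_C -> nat -> nat -> 'rV[R]_D.

(** All clients start the round at the same point, which factors out because the weights sum to
    1. *)
Lemma wbarE gs t k : wbar p gamma E w0 gs t k =
  wbar0 p gamma E w0 gs t - gamma *: \sum_i pw p i *: \sum_(l < k) gs i t l.
Proof.
rewrite /wbar /wloc; under eq_bigr do rewrite scalerBr.
rewrite sumrB -scaler_suml p1 scale1r scaler_sumr; congr (_ - _).
by apply: eq_bigr => i _; rewrite !scalerA mulrC.
Qed.

Lemma wbar_0 gs t : wbar p gamma E w0 gs t 0 = wbar0 p gamma E w0 gs t.
Proof.
rewrite wbarE big1 ?scaler0 ?subr0 // => i _.
by rewrite big_ord0 scaler0.
Qed.

Lemma wbar_S gs t k : wbar p gamma E w0 gs t k.+1 =
  wbar p gamma E w0 gs t k - gamma *: \sum_i pw p i *: gs i t k.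
Proof.
rewrite !wbarE -addrA -opprD -scalerDr -big_split /=; congr (_ - _ *: _).
by apply: eq_bigr => i _; rewrite big_ord_recr /= scalerDr.
Qed.

Lemma wbar_round gs t : wbar p gamma E w0 gs t E = wbar0 p gamma E w0 gs t.+1.
Proof. by []. Qed.

Lemma wbar_sub_wloc gs i t k :
  wbar p gamma E w0 gs t k - wloc p gamma E w0 gs i t k =
  gamma *: (\sum_(l < k) gs i t l - \sum_j pw p j *: \sum_(l < k) gs j t l).
Proof. by rewrite wbarE /wloc opprB addrC addrA subrK scalerBr. Qed.

(** Both points are averages of the same local endpoints of round [t], with weights [pw p j] and
    [p i n / pw p i], each family summing to 1. The common starting point therefore cancels. *)
Lemma wbar0_sub_uvec gs i t : pw p i != 0 ->
  wbar0 p gamma E w0 gs t.+1 - uvec p gamma E w0 gs i t.+1 =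
  gamma *: (\sum_n (p i n / pw p i) *: \sum_(l < E) gs n t l
            - \sum_j pw p j *: \sum_(l < E) gs j t l).
Proof.
move=> pi0.
have -> : uvec p gamma E w0 gs i t.+1 = wbar0 p gamma E w0 gs t -
    gamma *: \sum_n (p i n / pw p i) *: \sum_(l < E) gs n t l.
  rewrite /uvec /wloc; under eq_bigr do rewrite scalerBr.
  rewrite sumrB -scaler_suml scalerBr scalerA mulVf // scale1r; congr (_ - _).
  rewrite !scaler_sumr; apply: eq_bigr => n _; rewrite !scalerA.
  by congr (_ *: _); field.
by rewrite -wbar_round wbarE opprB addrC addrA subrK scalerBr.
Qed.

Lemma wbar_sub_wtil gs i t k :
  wbar p gamma E w0 gs t k - wtil p beta gamma E w0 gs i t k =
  beta *: (wbar p gamma E w0 gs t k - wloc p gamma E w0 gs i t k) +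
  (1 - beta) *: (wbar p gamma E w0 gs t k - uvec p gamma E w0 gs i t).
Proof.
rewrite /wtil !scalerBr addrACA -scalerDl addrC opprD [beta + _]addrC subrK scale1r.
by rewrite addrC.
Qed.

End Iterates.

(** * Properties that pass from the stochastic gradients to the iterates by linearity *)

Section IteratesClosed.
Context {R : fieldType} {C D : nat} {Omega : Type}.
Variables (p : 'I_C -> 'I_C -> R) (beta gamma : R) (E : nat) (w0 : 'rV[R]_D).
Variable g : 'I_C -> nat -> nat -> Omega -> 'rV[R]_D.
Variable Q : (Omega -> 'rV[R]_D) -> Prop.
Hypothesis Qcst : forall v, Q (fun=> v).
Hypothesis QD : forall X Y, Q X -> Q Y -> Q (fun w => X w + Y w).
Hypothesis QZ : forall x X, Q X -> Q (fun w => x *: X w).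
Local Notation gs w := (fun j s l => g j s l w).

Lemma closed_sum I (r : seq I) (X : I -> Omega -> 'rV[R]_D) :
  (forall i, Q (X i)) -> Q (fun w => \sum_(i <- r) X i w).
Proof.
move=> hX; elim: r => [|i r ih].
  by under [fun w => _]eq_fun do rewrite big_nil; exact: Qcst.
by under [fun w => _]eq_fun do rewrite big_cons; exact: QD.
Qed.

Lemma closedB X Y : Q X -> Q Y -> Q (fun w => X w - Y w).
Proof.
move=> hX hY; under [fun w => _]eq_fun do rewrite -scaleN1r.
by apply: QD => //; exact: QZ.
Qed.

(** [Q] is later square integrability, or measurability with respect to the past. The hypothesis
    covers exactly the range of gradients that enter: completed rounds and local steps below [E]. *)
Lemma closed_wbar0 t : (forall i s l, (s < t)%N -> (l < E)%N -> Q (g i s l)) ->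
  Q (fun w => wbar0 p gamma E w0 (gs w) t).
Proof.
elim: t => [|t ih] hg /=; first exact: Qcst.
apply: closed_sum => i; apply: QZ; apply: closedB.
  by apply: ih => j s l st lE; apply: hg => //; exact: ltnW.
by apply: QZ; apply: closed_sum => l; exact: hg.
Qed.

Lemma closed_wloc i t k :
  (forall i s l, (s < t)%N -> (l < E)%N -> Q (g i s l)) ->
  (forall l, (l < k)%N -> Q (g i t l)) ->
  Q (fun w => wloc p gamma E w0 (gs w) i t k).
Proof.
move=> hg hgt; rewrite /wloc; apply: closedB; first exact: closed_wbar0.
by apply: QZ; apply: closed_sum => l; exact: hgt.
Qed.

Lemma closed_wbar t k :
  (forall i s l, (s < t)%N -> (l < E)%N -> Q (g i s l)) ->
  (forall i l, (l < k)%N -> Q (g i t l)) ->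
  Q (fun w => wbar p gamma E w0 (gs w) t k).
Proof.
move=> hg hgt; apply: closed_sum => i; apply: QZ; apply: closed_wloc => //.
by move=> l; exact: hgt.
Qed.

Lemma closed_uvec i t :
  (forall i s l, (s < t)%N -> (l < E)%N -> Q (g i s l)) ->
  Q (fun w => uvec p gamma E w0 (gs w) i t).
Proof.
case: t => [|t] hg /=; first exact: Qcst.
apply: QZ; apply: closed_sum => n; apply: QZ; apply: closed_wloc.
  by move=> j s l st lE; apply: hg => //; exact: ltnW.
by move=> l lE; exact: hg.
Qed.

Lemma closed_wtil i t k :
  (forall i s l, (s < t)%N -> (l < E)%N -> Q (g i s l)) ->
  (forall l, (l < k)%N -> Q (g i t l)) ->
  Q (fun w => wtil p beta gamma E w0 (gs w) i t k).
Proof.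
move=> hg hgt; apply: QD; apply: QZ; first exact: closed_wloc.
exact: closed_uvec.
Qed.

End IteratesClosed.

(** * Square-integrable random vectors and mean-square bounds *)

Section VectorExpectation.
Context {R : realType} {d : measure_display} {Omega : measurableType d}.
Variables (P : probability Omega R) (D : nat).
Implicit Types X Y : Omega -> 'rV[R]_D.

Definition vsqint X := forall c, sqint P (fun w => X w ord0 c).

Lemma vsqint_cst v : vsqint (fun=> v).
Proof. by move=> c; exact: sqint_cst. Qed.

Lemma vsqintD X Y : vsqint X -> vsqint Y -> vsqint (fun w => X w + Y w).
Proof.
move=> hX hY c; under [fun w => _]eq_fun do rewrite mxE.
exact: sqintD.
Qed.

Lemma vsqintZ x X : vsqint X -> vsqint (fun w => x *: X w).
Proof.
move=> hX c; under [fun w => _]eq_fun do rewrite mxE.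
exact: sqintZ.
Qed.

Lemma vsqintB X Y : vsqint X -> vsqint Y -> vsqint (fun w => X w - Y w).
Proof. exact: (closedB vsqintD vsqintZ). Qed.

Lemma vsqint_sum I (r : seq I) (X : I -> Omega -> 'rV[R]_D) :
  (forall i, vsqint (X i)) -> vsqint (fun w => \sum_(i <- r) X i w).
Proof. exact: (closed_sum vsqint_cst vsqintD). Qed.

Lemma rint_dotv X Y : vsqint X -> vsqint Y -> rint P (fun w => dotv (X w) (Y w)).
Proof. by move=> hX hY; apply: rint_sum => c; exact: sqint_mul. Qed.

Lemma rint_sqnorm X : vsqint X -> rint P (fun w => sqnorm (X w)).
Proof. by move=> hX; exact: rint_dotv. Qed.

(** A finite bound on the extended integral of a nonnegative function makes it integrable, and it
    dominates the square of each coordinate. This is how the gradient norm assumption yields square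
    integrability. *)
Lemma vsqint_bounded X (M : R) :
  (forall c, measurable_fun setT (fun w => X w ord0 c)) ->
  (\int[P]_w (sqnorm (X w))%:E <= M%:E)%E -> vsqint X.
Proof.
move=> mX XM.
have mS : measurable_fun setT (fun w => sqnorm (X w)).
  by apply: measurable_sum => c; exact: measurable_funM.
have iS : rint P (fun w => sqnorm (X w)).
  apply/integrableP; split; first exact/measurable_EFinP.
  apply: (@le_lt_trans _ _ M%:E); last exact: ltry.
  under eq_integral => w _ do rewrite /= ger0_norm ?sqnorm_ge0 //.
  exact: XM.
move=> c; split; first exact: mX.
apply: (rint_le _ _ iS); first exact: measurable_funX.
by move=> w; rewrite ger0_norm ?sqr_ge0 // sqnorm_comp.
Qed.

(** Comparison with the value at 0: [|f X|^2] is at most [2 (|f 0|^2 + L^2 |X|^2)]. *)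
Lemma vsqint_lip (f : 'rV[R]_D -> 'rV[R]_D) (L : R) X :
  (forall w v, sqnorm (f w - f v) <= L ^+ 2 * sqnorm (w - v)) ->
  vsqint X -> vsqint (fun w => f (X w)).
Proof.
move=> lip hX c; have mX c' : measurable_fun setT (fun w => X w ord0 c').
  by have [] := hX c'.
have mf : measurable_fun setT (fun w => f (X w) ord0 c).
  exact: (measurable_fun_continuous_rV (f := fun v => f v ord0 c) mX (lip_continuous lip)).
split=> //.
have i1 : rint P (fun w => 2 * (sqnorm (f 0) + L ^+ 2 * sqnorm (X w))).
  by apply: rintZ; apply: rintD; [exact: rint_cst | apply: rintZ; exact: rint_sqnorm].
apply: (rint_le _ _ i1); first exact: measurable_funX.
move=> w; rewrite ger0_norm ?sqr_ge0 //; apply: le_trans (sqnorm_comp _ _) _.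
rewrite -[f (X w)](subrK (f 0)) addrC; apply: le_trans (sqnormD_le _ _) _.
by rewrite ler_pM2l // lerD2l; have := lip (X w) 0; rewrite subr0.
Qed.

(** Square integrability is bundled in because the real-valued integral takes the default value 0
    when the extended one is infinite, which would make the bound meaningless. *)
Definition msq_le X (M : R) := vsqint X /\ \int[P]_w sqnorm (X w) <= M.

Lemma msq_le_trans X M N : msq_le X M -> M <= N -> msq_le X N.
Proof. by move=> [hX XM] MN; split=> //; exact: le_trans MN. Qed.

Lemma msq_leZ x X M : msq_le X M -> msq_le (fun w => x *: X w) (x ^+ 2 * M).
Proof.
move=> [hX XM]; split; first exact: vsqintZ.
under eq_Rintegral do rewrite sqnormZ.
by rewrite RintegralZl ?ler_wpM2l ?sqr_ge0 //; exact: rint_sqnorm.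
Qed.

Lemma msq_leD X Y M N : msq_le X M -> msq_le Y N ->
  msq_le (fun w => X w + Y w) (2 * (M + N)).
Proof.
move=> [hX XM] [hY YN]; split; first exact: vsqintD.
have iX := rint_sqnorm hX; have iY := rint_sqnorm hY.
apply: (@le_trans _ _ (\int[P]_w (2 * (sqnorm (X w) + sqnorm (Y w))))).
  apply: le_Rintegral => //; first exact/rint_sqnorm/vsqintD.
    by apply: rintZ; exact: rintD.
  by move=> w _; exact: sqnormD_le.
rewrite RintegralZl //; last exact: rintD.
by rewrite RintegralD // ler_pM2l // lerD.
Qed.

Lemma msq_leB X Y M N : msq_le X M -> msq_le Y N ->
  msq_le (fun w => X w - Y w) (2 * (M + N)).
Proof.
move=> XM /(msq_leZ (-1)); rewrite sqrrN expr1n mul1r => /(msq_leD XM).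
by congr msq_le; apply/funext => w; rewrite scaleN1r.
Qed.

(** Weighted Cauchy-Schwarz under the integral. Weights of sum 1 preserve the bound, and [k] unit
    weights multiply it by [k ^ 2]. *)
Lemma msq_le_wsum (I : finType) (q : I -> R) (X : I -> Omega -> 'rV[R]_D) M :
  (forall i, 0 <= q i) -> (forall i, msq_le (X i) M) ->
  msq_le (fun w => \sum_i q i *: X i w) ((\sum_i q i) ^+ 2 * M).
Proof.
move=> q0 XM.
have hX i : vsqint (X i) by have [] := XM i.
have iX i : rint P (fun w => q i * sqnorm (X i w)).
  by apply: rintZ; exact: rint_sqnorm.
have hS : vsqint (fun w => \sum_i q i *: X i w).
  by apply: vsqint_sum => i; exact: vsqintZ.
split=> //.
apply: (@le_trans _ _ (\int[P]_w ((\sum_i q i) * \sum_i q i * sqnorm (X i w)))).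
  apply: le_Rintegral => //; first exact: rint_sqnorm.
    by apply: rintZ; exact: rint_sum.
  by move=> w _; exact: sqnorm_wsum_le.
rewrite RintegralZl //; last exact: rint_sum.
rewrite Rintegral_sum // expr2 -mulrA ler_wpM2l ?sumr_ge0 //.
rewrite mulr_suml; apply: ler_sum => i _.
rewrite RintegralZl //; last exact: rint_sqnorm.
by rewrite ler_wpM2l //; have [] := XM i.
Qed.

Lemma msq_le_convex (I : finType) (q : I -> R) (X : I -> Omega -> 'rV[R]_D) M :
  (forall i, 0 <= q i) -> \sum_i q i = 1 -> (forall i, msq_le (X i) M) ->
  msq_le (fun w => \sum_i q i *: X i w) M.
Proof.
by move=> q0 q1 XM; have := msq_le_wsum q0 XM; rewrite q1 expr1n mul1r.
Qed.

Lemma msq_le_sum (k : nat) (X : nat -> Omega -> 'rV[R]_D) M :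
  (forall l, (l < k)%N -> msq_le (X l) M) ->
  msq_le (fun w => \sum_(l < k) X l w) (k%:R ^+ 2 * M).
Proof.
move=> XM.
have := @msq_le_wsum _ (fun=> 1) (fun l : 'I_k => X l) M (fun=> ler01)
  (fun l => XM l (ltn_ord l)).
rewrite sumr_const card_ord; congr msq_le; apply/funext => w.
by apply: eq_bigr => l _; rewrite scale1r.
Qed.

End VectorExpectation.

(** * Measurability with respect to a sub-sigma-algebra *)

Section SubSigmaAlgebra.
Context {R : realType} {d : measure_display} {Omega : measurableType d}.
Variable H : set (set Omega).
Hypothesis sH : sigma_algebra setT H.
Implicit Types Y : Omega -> R.

(** A sigma-algebra equals the one it generates, so the general closure properties of measurable
    functions become available for [H]. *)
Lemma measurable_wrtP Y : measurable_wrt H Y <->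
  @measurable_fun _ _ (g_sigma_algebraType H) _ setT Y.
Proof.
have HE : <<s H >> = H.
  by apply/seteqP; split; [exact: smallest_sub | exact: sub_gen_smallest].
split=> [HY _ B mB|mY B mB].
  by rewrite setTI; change (<<s H >> (Y @^-1` B)); rewrite HE; exact: HY.
have := mY measurableT B mB; rewrite setTI.
by change (<<s H >> (Y @^-1` B) -> H (Y @^-1` B)); rewrite HE.
Qed.

Section RandomVectors.
Variable D : nat.
Implicit Types X Z : Omega -> 'rV[R]_D.

Definition vmeasurable_wrt X := forall c, measurable_wrt H (fun w => X w ord0 c).

Lemma vmeasurable_wrt_cst v : vmeasurable_wrt (fun=> v).
Proof. by move=> c; apply/measurable_wrtP; exact: measurable_cst. Qed.

Lemma vmeasurable_wrtD X Z : vmeasurable_wrt X -> vmeasurable_wrt Z ->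
  vmeasurable_wrt (fun w => X w + Z w).
Proof.
move=> hX hY c; under [fun w => _]eq_fun do rewrite mxE.
by apply/measurable_wrtP/measurable_funD; apply/measurable_wrtP.
Qed.

Lemma vmeasurable_wrtZ x X : vmeasurable_wrt X ->
  vmeasurable_wrt (fun w => x *: X w).
Proof.
move=> hX c; under [fun w => _]eq_fun do rewrite mxE.
apply/measurable_wrtP/measurable_funM; first exact: measurable_cst.
exact/measurable_wrtP.
Qed.

Lemma vmeasurable_wrt_continuous (f : 'rV[R]_D -> R) X : continuous f ->
  vmeasurable_wrt X -> measurable_wrt H (fun w => f (X w)).
Proof.
move=> cf hX; apply/measurable_wrtP/measurable_fun_continuous_rV => // c.
exact/measurable_wrtP.
Qed.

End RandomVectors.
End SubSigmaAlgebra.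

(** * The events known before a local step *)

Section Past.
Context {R : realType} {d : measure_display} {Omega : measurableType d}.
Variables (P : probability Omega R) (C D : nat).
Variable g : 'I_C -> nat -> nat -> Omega -> 'rV[R]_D.

(* [past g t k] also records gradients indexed by local steps l >= E, whose
   measurability is not assumed, so only its measurable events are kept. *)
Definition mpast (t k : nat) : set (set Omega) := past g t k `&` d.-measurable.

Lemma sigma_algebra_mpast t k : sigma_algebra setT (mpast t k).
Proof.
have [s0 sC sU] : sigma_algebra setT (past g t k) by exact: smallest_sigma_algebra.
split.
- by split; [exact: s0 | exact: measurable0].
- move=> A [pA mA]; split; first exact: sC.
  by apply: measurableD.
- move=> F hF; split; first by apply: sU => n; have [] := hF n.
  by apply: bigcupT_measurable => n; have [] := hF n.
Qed.

Lemma mpastT t k : mpast t k setT.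
Proof.
have [s0 sC _] := sigma_algebra_mpast t k.
by have := sC _ s0; rewrite setD0.
Qed.

Lemma mpast_grad t k j s l : lexlt s l t k ->
  (forall c, measurable_fun setT (fun w => g j s l w ord0 c)) ->
  vmeasurable_wrt (mpast t k) (g j s l).
Proof.
move=> lt mg c B mB; split.
  by apply: sub_gen_smallest; exists j, s, l, c, B.
by rewrite -[X in measurable X]setTI; exact: mg.
Qed.

(** [Y] stays measurable for the smaller family because its integrability already makes it
    measurable on [Omega]. *)
Lemma mpast_cond_exp t k X Y : is_cond_exp P (past g t k) X Y ->
  is_cond_exp P (mpast t k) X Y.
Proof.
move=> [hY iX iY e]; split=> // [B mB|A [pA _]]; last exact: e.
split; first exact: hY.
have mY : measurable_fun setT Y by exact: (@rint_meas _ _ _ P).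
by rewrite -[X in measurable X]setTI; exact: mY.
Qed.

Lemma mpast_cond_indep t k (X : 'I_C -> Omega -> 'rV[R]_D) :
  cond_indep P (past g t k) X -> cond_indep P (mpast t k) X.
Proof.
move=> ci B mB; have [Y [Z [hY hZ e]]] := ci B mB.
by exists Y, Z; split=> // [i|]; exact: mpast_cond_exp.
Qed.

End Past.

(** * One step in expectation *)

Section Step.
Context {R : realType} {d : measure_display} {Omega : measurableType d}.
Variables (P : probability Omega R) (I : finType) (q : I -> R).

Lemma Rintegral_wsum_mul (a : I -> Omega -> R) Y :
  (forall i, sqint P (a i)) -> sqint P Y ->
  \int[P]_w ((\sum_i q i * a i w) * Y w) = \sum_i q i * \int[P]_w (a i w * Y w).
Proof.
move=> sa sY; have ia i := sqint_mul (sa i) sY.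
under eq_Rintegral do rewrite mulr_suml.
under eq_Rintegral do under eq_bigr do rewrite -mulrA.
rewrite Rintegral_sum; last by move=> i; exact: rintZ.
by apply: eq_bigr => i _; rewrite RintegralZl //; exact: ia.
Qed.

(** Write [b i] as the mean [a i] plus the noise [b' i]. Means are orthogonal to noises and distinct
    noises to each other, so only the diagonal noise terms survive, with squared weights. *)
Lemma second_moment_wsum (a b : I -> Omega -> R) :
  (forall i, sqint P (a i)) -> (forall i, sqint P (b i)) ->
  (forall i j, \int[P]_w (a i w * (b j w - a j w)) = 0) ->
  (forall i j, i != j ->
     \int[P]_w ((b i w - a i w) * (b j w - a j w)) = 0) ->
  \int[P]_w ((\sum_i q i * b i w) ^+ 2) =
  \int[P]_w ((\sum_i q i * a i w) ^+ 2) +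
  \sum_i q i ^+ 2 * \int[P]_w ((b i w - a i w) ^+ 2).
Proof.
move=> sa sb0 ab0 bb0.
pose b' i w := b i w - a i w.
have sb i : sqint P (b' i) by exact: sqintB.
have sA : sqint P (fun w => \sum_i q i * a i w).
  by apply: sqint_sum => i; exact: sqintZ.
have sB : sqint P (fun w => \sum_i q i * b' i w).
  by apply: sqint_sum => i; exact: sqintZ.
have -> : (fun w => (\sum_i q i * b i w) ^+ 2) = (fun w =>
   (\sum_i q i * a i w) ^+ 2 + (2 * ((\sum_i q i * a i w) * (\sum_i q i * b' i w))
   + (\sum_i q i * b' i w) * (\sum_i q i * b' i w))).
  apply/funext => w.
  have -> : \sum_i q i * b i w = \sum_i q i * a i w + \sum_i q i * b' i w.
    by rewrite -big_split; apply: eq_bigr => i _; rewrite /b' /=; ring.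
  by ring.
have iAB := sqint_mul sA sB; have iBB := sqint_mul sB sB.
have [_ iAA] := sA.
rewrite RintegralD //; last by apply: rintD => //; exact: rintZ.
rewrite RintegralD //; last exact: rintZ.
rewrite RintegralZl // (Rintegral_wsum_mul sa sB) (Rintegral_wsum_mul sb sB) big1 => [|i _]; last first.
  under eq_Rintegral do rewrite mulrC.
  rewrite (Rintegral_wsum_mul sb (sa i)) big1 ?mulr0 // => j _.
  by under eq_Rintegral do rewrite mulrC; rewrite [X in _ * X](ab0 i j) mulr0.
rewrite mulr0 add0r; congr (_ + _); apply: eq_bigr => i _.
under eq_Rintegral do rewrite mulrC.
rewrite (Rintegral_wsum_mul sb (sb i)) (bigD1 i) //= [X in _ + X]big1 => [|j ji]; last first.
  by rewrite [X in _ * X](bb0 j i ji) mulr0.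
by rewrite addr0 mulrA -expr2; congr (_ * _); apply: eq_Rintegral => w _; rewrite -expr2.
Qed.

Variable D : nat.
Implicit Types a b : I -> Omega -> 'rV[R]_D.

Lemma wsumE a w c : (\sum_i q i *: a i w) ord0 c = \sum_i q i * a i w ord0 c.
Proof. by rewrite summxE; apply: eq_bigr => i _; rewrite mxE. Qed.

Lemma Rintegral_sqnorm (X : Omega -> 'rV[R]_D) : vsqint P X ->
  \int[P]_w sqnorm (X w) = \sum_c \int[P]_w (X w ord0 c ^+ 2).
Proof.
move=> sX; under eq_Rintegral do rewrite sqnormE.
by rewrite Rintegral_sum // => c; have [] := sX c.
Qed.

Lemma second_moment_sqnorm a b (s : R) :
  (forall i, vsqint P (a i)) -> (forall i, vsqint P (b i)) ->
  (forall i j c, \int[P]_w (a i w ord0 c * (b j w ord0 c - a j w ord0 c)) = 0) ->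
  (forall i j c, i != j -> \int[P]_w ((b i w ord0 c - a i w ord0 c) *
      (b j w ord0 c - a j w ord0 c)) = 0) ->
  (forall i, \int[P]_w sqnorm (b i w - a i w) <= s) ->
  \int[P]_w sqnorm (\sum_i q i *: b i w) <=
  \int[P]_w sqnorm (\sum_i q i *: a i w) + (\sum_i q i ^+ 2) * s.
Proof.
move=> sa sb ab0 bb0 bs.
have sS f : (forall i, vsqint P (f i)) -> vsqint P (fun w => \sum_i q i *: f i w).
  by move=> sf; apply: vsqint_sum => i; exact: vsqintZ.
rewrite !Rintegral_sqnorm; [|exact: sS..].
rewrite (eq_bigr (fun c => \int[P]_w ((\sum_i q i *: a i w) ord0 c ^+ 2) +
   \sum_i q i ^+ 2 * \int[P]_w ((b i w ord0 c - a i w ord0 c) ^+ 2))); last first.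
  move=> c _; under eq_Rintegral do rewrite wsumE.
  under [X in _ = X + _]eq_Rintegral do rewrite wsumE.
  apply: second_moment_wsum => [i|i|i j|i j]; [exact: sa|exact: sb|exact: ab0|exact: bb0].
rewrite big_split lerD2l exchange_big /= mulr_suml; apply: ler_sum => i _.
rewrite -mulr_sumr ler_wpM2l ?sqr_ge0 //; apply: le_trans (bs i).
rewrite Rintegral_sqnorm; last exact: vsqintB.
by apply: ler_sum => c _; under [leRHS]eq_Rintegral do rewrite !mxE.
Qed.

(** Here [b i] plays the stochastic gradient, [a i] its conditional mean and [delta] the mean-square
    error of [a i] as a gradient at [X]. The probabilistic input is reduced to integral identities
    on coordinates. *)
Lemma expected_descent (F : 'rV[R]_D -> R) (dF : I -> 'rV[R]_D -> 'rV[R]_D)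
    (L gamma s delta finf : R) (X : Omega -> 'rV[R]_D) a b :
  (forall i, 0 <= q i) -> \sum_i q i = 1 -> 0 < L -> 0 <= gamma -> L * gamma <= 1 ->
  let dG w := \sum_i q i *: dF i w in
  let X' w := X w - gamma *: \sum_i q i *: b i w in
  (forall w v, F (w + v) <= F w + dotv (dG w) v + L / 2 * sqnorm v) ->
  (forall w, finf <= F w) ->
  vsqint P (fun w => dG (X w)) ->
  (forall i, vsqint P (a i)) -> (forall i, vsqint P (b i)) ->
  (forall i c, \int[P]_w (b i w ord0 c * dG (X w) ord0 c) =
               \int[P]_w (a i w ord0 c * dG (X w) ord0 c)) ->
  (forall i j c, \int[P]_w (a i w ord0 c * (b j w ord0 c - a j w ord0 c)) = 0) ->
  (forall i j c, i != j -> \int[P]_w ((b i w ord0 c - a i w ord0 c) *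
      (b j w ord0 c - a j w ord0 c)) = 0) ->
  (forall i, \int[P]_w sqnorm (b i w - a i w) <= s) ->
  (forall i, msq_le P (fun w => dF i (X w) - a i w) delta) ->
  rint P (fun w => F (X w)) -> measurable_fun setT (fun w => F (X' w)) ->
  rint P (fun w => F (X' w)) /\
  \int[P]_w F (X' w) <= \int[P]_w F (X w) - gamma / 2 * \int[P]_w sqnorm (dG (X w))
    + gamma / 2 * delta + L * gamma ^+ 2 / 2 * ((\sum_i q i ^+ 2) * s).
Proof.
move=> q0 q1 L0 g0 Lg dG X' smooth Finf sG sa sb o1 o2 o3 bs dist iF mF'.
pose A w := \sum_i q i *: a i w; pose B w := \sum_i q i *: b i w.
have sA : vsqint P A by apply: vsqint_sum => i; exact: vsqintZ.
have sB : vsqint P B by apply: vsqint_sum => i; exact: vsqintZ.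
have iGB := rint_dotv sG sB; have iGA := rint_dotv sG sA.
have iG := rint_sqnorm sG; have iA := rint_sqnorm sA; have iB := rint_sqnorm sB.
pose U w := F (X w) + (- gamma * dotv (dG (X w)) (B w) + L / 2 * gamma ^+ 2 * sqnorm (B w)).
have iU : rint P U by apply: rintD => //; apply: rintD; exact: rintZ.
have FU w : F (X' w) <= U w.
  have := smooth (X w) (- gamma *: B w).
  by rewrite dotvZr sqnormZ sqrrN /X' /U /B -scaleNr; move=> h; lra.
(* [F (X' w)] lies between the constant [finf] and the integrable [U w]. *)
have iF' : rint P (fun w => F (X' w)).
  have iM : rint P (fun w => `|finf| + `|U w|).
    by apply: rintD; [exact: rint_cst | exact: integrable_norm].
  apply: (rint_le mF' _ iM) => w; rewrite ler_norml; apply/andP; split.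
    apply: le_trans (Finf _); rewrite opprD -lerBrDl.
    have := ler_norm (- finf); have := normr_ge0 (U w); rewrite normrN; lra.
  by have := FU w; have := ler_norm (U w); have := normr_ge0 finf; lra.
split=> //.
have EU : \int[P]_w U w = \int[P]_w F (X w) - gamma * \int[P]_w dotv (dG (X w)) (B w)
    + L / 2 * gamma ^+ 2 * \int[P]_w sqnorm (B w).
  rewrite RintegralD //; last by apply: rintD; exact: rintZ.
  by rewrite RintegralD ?RintegralZl //; [ring | exact: rintZ..].
have ED : \int[P]_w dotv (dG (X w)) (B w) = \int[P]_w dotv (dG (X w)) (A w).
  (* One expansion into coordinates and clients, used for both [b] and [a], so that [o1] can be
     applied term by term. *)
  have E f : (forall i, vsqint P (f i)) ->
      \int[P]_w dotv (dG (X w)) (\sum_i q i *: f i w) =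
      \sum_c \sum_i q i * \int[P]_w (f i w ord0 c * dG (X w) ord0 c).
    move=> sf; have sS : vsqint P (fun w => \sum_i q i *: f i w).
      by apply: vsqint_sum => i; exact: vsqintZ.
    rewrite Rintegral_sum; last by move=> c; exact: (sqint_mul (sG c) (sS c)).
    apply: eq_bigr => c _; under eq_Rintegral do rewrite mulrC wsumE.
    by apply: Rintegral_wsum_mul => [i|]; [exact: sf | exact: sG].
  rewrite !E //; apply: eq_bigr => c _; apply: eq_bigr => i _.
  by rewrite o1.
have sGA : vsqint P (fun w => dG (X w) - A w) by exact: vsqintB.
have iGA2 := rint_sqnorm sGA.
(* Polarization produces the decrease in [sqnorm (dG (X w))], and also a negative multiple of
   [sqnorm (A w)] to be spent in [h3]. *)
have polar : 2 * \int[P]_w dotv (dG (X w)) (A w) =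
    \int[P]_w sqnorm (dG (X w)) + \int[P]_w sqnorm (A w)
    - \int[P]_w sqnorm (dG (X w) - A w).
  rewrite -RintegralZl // -RintegralD // -RintegralB //; last exact: rintD.
  by apply: eq_Rintegral => w _; rewrite sqnormB; ring.
have Hd : \int[P]_w sqnorm (dG (X w) - A w) <= delta.
  have [_] := msq_le_convex q0 q1 dist; congr (_ <= _); apply: eq_Rintegral => w _.
  by rewrite -sumrB; congr sqnorm; apply: eq_bigr => i _; rewrite scalerBr.
have HB := second_moment_sqnorm sa sb o2 o3 bs.
have HA : 0 <= \int[P]_w sqnorm (A w) by apply: Rintegral_ge0 => w _; exact: sqnorm_ge0.
have : \int[P]_w F (X' w) <= \int[P]_w U w by apply: le_Rintegral.
rewrite EU ED; move: polar Hd HB HA; rewrite -/(A _) -/(B _).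
set x := \int[P]_w dotv _ _; set y := \int[P]_w sqnorm (dG _).
set z := \int[P]_w sqnorm (A _); set t := \int[P]_w sqnorm (dG _ - _).
set u := \int[P]_w sqnorm (B _); set v := _ * s.
move=> polar Hd HB HA /le_trans; apply.
have -> : x = (y + z - t) / 2 by rewrite -polar; field.
have h1 : L / 2 * gamma ^+ 2 * u <= L / 2 * gamma ^+ 2 * (z + v).
  by rewrite ler_wpM2l // mulr_ge0 ?sqr_ge0 // divr_ge0 ?ltW.
have h2 : gamma * t <= gamma * delta by rewrite ler_wpM2l.
(* The second-order term in [z] is absorbed by the [- gamma / 2 * z] coming from polarization. *)
have h3 : L * gamma * (gamma * z) <= 1 * (gamma * z).
  by rewrite ler_wpM2r // mulr_ge0.
rewrite (_ : L / 2 * gamma ^+ 2 * (z + v) =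
  (L * gamma * (gamma * z)) / 2 + L * gamma ^+ 2 / 2 * v) in h1; last by field.
lra.
Qed.

End Step.

(** * Drift of the perturbed iterates *)

Section Drift.
Context {R : realType} {d : measure_display} {Omega : measurableType d}.
Variables (P : probability Omega R) (C D : nat) (p : 'I_C -> 'I_C -> R).
Variables (beta gamma M : R) (E : nat) (w0 : 'rV[R]_D).
Variable g : 'I_C -> nat -> nat -> Omega -> 'rV[R]_D.
Hypothesis p0 : forall i n, 0 <= p i n.
Hypothesis p1 : \sum_i pw p i = 1.
Hypothesis ppos : forall i, 0 < pw p i.
Hypothesis beta01 : 0 < beta < 1.
Local Notation gs w := (fun j s l => g j s l w).

Lemma pw_ge0 i : 0 <= pw p i.
Proof. exact: ltW. Qed.

(** Each sum of at most [E] gradients has mean square at most [N], and so does any average of such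
    sums. The parts then cost at most 4 and 10 times [gamma ^+ 2 * N]; both are rounded up to 16,
    which yields the constant 4 of the final bound. *)
Lemma msq_le_drift i t k : (k <= E)%N ->
  (forall j s l, (s <= t)%N -> (l < E)%N -> msq_le P (g j s l) M) -> 0 <= M ->
  msq_le P (fun w => wbar p gamma E w0 (gs w) t k - wtil p beta gamma E w0 (gs w) i t k)
    (16 * gamma ^+ 2 * (E%:R ^+ 2 * M)).
Proof.
move=> kE gM M0; set N := E%:R ^+ 2 * M.
have N0 : 0 <= N by rewrite mulr_ge0 ?sqr_ge0.
have gN0 : 0 <= gamma ^+ 2 * N by rewrite mulr_ge0 ?sqr_ge0.
have S_le j s m : (s <= t)%N -> (m <= E)%N ->
    msq_le P (fun w => \sum_(l < m) g j s l w) N.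
  move=> st mE; apply: (@msq_le_trans _ _ _ _ _ _ (m%:R ^+ 2 * M)).
    by apply: (@msq_le_sum _ _ _ P _ m (g j s)) => l lm; apply: gM => //; exact: leq_trans mE.
  by rewrite /N ler_wpM2r // ler_pXn2r ?nnegrE // ler_nat.
have pS_le s m : (s <= t)%N -> (m <= E)%N ->
    msq_le P (fun w => \sum_j pw p j *: \sum_(l < m) g j s l w) N.
  by move=> st mE; apply: msq_le_convex => [j|//|j]; [exact: pw_ge0 | exact: S_le].
have a_le : msq_le P (fun w => wbar p gamma E w0 (gs w) t k - wloc p gamma E w0 (gs w) i t k)
    (16 * gamma ^+ 2 * N).
  under [fun w => _]eq_fun do rewrite (wbar_sub_wloc _ _ _ p1).
  apply: msq_le_trans (msq_leZ gamma (msq_leB (S_le i t k _ kE) (pS_le t k _ kE))) _ => //.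
  lra.
have b_le : msq_le P (fun w => wbar p gamma E w0 (gs w) t k - uvec p gamma E w0 (gs w) i t)
    (16 * gamma ^+ 2 * N).
  under [fun w => _]eq_fun do rewrite (wbarE _ _ _ p1) addrAC.
  have pSk := msq_leZ gamma (pS_le t k (leqnn t) kE).
  (* In round 0 the vector [uvec] is the starting point, so only the current partial sum remains.
     Later rounds also contribute the gap between two averages over the previous round. *)
  have [t0|[t' t't]] : t = 0%N \/ exists t', t = t'.+1.
    by case: (t) => [|t']; [left | right; exists t'].
    rewrite t0 in pSk *; under [fun w => _]eq_fun do rewrite /= subrr sub0r -scaleN1r.
    by apply: msq_le_trans (msq_leZ (-1) pSk) _; rewrite sqrrN expr1n mul1r; lra.
  have pi0 : pw p i != 0 by rewrite gt_eqF.
  have q0 n : 0 <= p i n / pw p i by rewrite divr_ge0 ?pw_ge0.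
  have q1 : \sum_n p i n / pw p i = 1 by rewrite -mulr_suml divff.
  have t'le : (t' <= t)%N by rewrite t't.
  have bE w : wbar0 p gamma E w0 (gs w) t - uvec p gamma E w0 (gs w) i t =
      gamma *: (\sum_n (p i n / pw p i) *: \sum_(l < E) g n t' l w
                - \sum_j pw p j *: \sum_(l < E) g j t' l w).
    by rewrite t't (wbar0_sub_uvec _ _ _ p1 _ _ pi0).
  under [fun w => _]eq_fun do rewrite bE.
  apply: msq_le_trans (msq_leB (msq_leZ gamma (msq_leB
    (msq_le_convex q0 q1 (fun n => S_le n t' E t'le (leqnn E)))
    (pS_le t' E t'le (leqnn E)))) pSk) _; lra.
have /andP[b0 b1] := beta01.
(* The two-term combination is read as an average indexed by [bool], so convexity bounds it without
   an extra factor 2. *)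
have := @msq_le_convex _ _ _ P D bool (fun b => if b then beta else 1 - beta)
  (fun b w => if b then wbar p gamma E w0 (gs w) t k - wloc p gamma E w0 (gs w) i t k
              else wbar p gamma E w0 (gs w) t k - uvec p gamma E w0 (gs w) i t)
  (16 * gamma ^+ 2 * N).
have -> : (fun w => \sum_(b : bool) (if b then beta else 1 - beta) *:
    (if b then wbar p gamma E w0 (gs w) t k - wloc p gamma E w0 (gs w) i t k
     else wbar p gamma E w0 (gs w) t k - uvec p gamma E w0 (gs w) i t)) =
  (fun w => wbar p gamma E w0 (gs w) t k - wtil p beta gamma E w0 (gs w) i t k).
  by apply/funext => w; rewrite big_bool /= wbar_sub_wtil.
apply; [|by rewrite big_bool /= addrC subrK|by case].
by case; rewrite ?subr_ge0 ltW.
Qed.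

End Drift.

(** * Telescoping over rounds and the convergence bound *)

Lemma sum_telescope2 (R : zmodType) (a : nat -> nat -> R) (T E : nat) :
  (forall t, a t E = a t.+1 0%N) ->
  \sum_(t < T) \sum_(k < E) (a t k - a t k.+1) = a 0%N 0%N - a T 0%N.
Proof.
move=> aE; have inner t : \sum_(k < E) (a t k - a t k.+1) = a t 0%N - a t.+1 0%N.
  rewrite -aE; elim: {aE}E => [|n ih]; first by rewrite big_ord0 subrr.
  by rewrite big_ord_recr /= ih addrA subrK.
under eq_bigr do rewrite inner.
elim: T => [|n ih]; first by rewrite big_ord0 subrr.
by rewrite big_ord_recr /= ih addrA subrK.
Qed.

Unset Implicit Arguments.
Theorem theorem4 (R : realType) (d : measure_display) (Omega : measurableType d)
  (P : probability Omega R)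
  (C D : nat) (p : 'I_C -> 'I_C -> R)
  (F : 'I_C -> 'rV[R]_D -> R) (gradF : 'I_C -> 'rV[R]_D -> 'rV[R]_D)
  (L sigma G finf beta : R) (T E : nat) (w0 : 'rV[R]_D)
  (g : 'I_C -> nat -> nat -> Omega -> 'rV[R]_D) :
  (* similarity weights *)
  (forall i n, 0 <= p i n) ->
  (forall i n, p i n = p n i) ->
  (forall i, p i i = 0) ->
  \sum_(i < C) \sum_(n < C) p i n = 1 ->
  (forall i, 0 < pw p i) ->
  (* parameters *)
  0 < beta < 1 -> (1 <= T)%N -> (1 <= E)%N -> 0 < L ->
  (* gradF i is the gradient of F i *)
  (forall i w, differentiable (F i) w /\
     forall v, 'd (F i) w v = dotv (gradF i w) v) ->
  (* L-smoothness *)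
  (forall i w v, Num.sqrt (sqnorm (gradF i w - gradF i v))
                   <= L * Num.sqrt (sqnorm (w - v))) ->
  (* lower-bounded objective *)
  (forall w, finf <= Fglob p F w) ->
  let gamma := (2 * L * Num.sqrt (T * E)%:R)^-1 in
  let wt := fun w i t k =>
    wtil p beta gamma E w0 (fun j s l => g j s l w) i t k in
  (* the stochastic gradients are random vectors *)
  (forall i t k c, (t < T)%N -> (k < E)%N ->
     measurable_fun setT (fun w => g i t k w ord0 c)) ->
  (* unbiased given the past: E[g_i(wtilde^i_{t,k}) | past] = grad F_i(wtilde^i_{t,k}) *)
  (forall i t k c, (t < T)%N -> (k < E)%N ->
     is_cond_exp P (past g t k) (fun w => g i t k w ord0 c)
                   (fun w => gradF i (wt w i t k) ord0 c)) ->
  (* sampled independently across clients given the past *)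
  (forall t k, (t < T)%N -> (k < E)%N ->
     cond_indep P (past g t k) (fun i => g i t k)) ->
  (* bounded variance *)
  (forall i t k, (t < T)%N -> (k < E)%N ->
     (\int[P]_w (sqnorm (g i t k w - gradF i (wt w i t k)))%:E
        <= (sigma ^+ 2)%:E)%E) ->
  (* bounded stochastic gradient norm *)
  (forall i t k, (t < T)%N -> (k < E)%N ->
     (\int[P]_w (sqnorm (g i t k w))%:E <= (G ^+ 2)%:E)%E) ->
  let Delta := Fglob p F w0 - finf in
  let S := \sum_(i < C) pw p i ^+ 2 in
  (* E || grad F (what_T) ||^2, what_T uniform over {wbar_{t,k} : t < T, k < E} *)
  (((T * E)%:R^-1)%:E *
     \sum_(t < T) \sum_(k < E)
        \int[P]_w (sqnorm (gradglob p gradF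
                     (wbar p gamma E w0 (fun j s l => g j s l w) t k)))%:E
   <= ((Num.sqrt T%:R)^-1 *
         (4 * L * Delta / Num.sqrt E%:R + S * sigma ^+ 2 / (2 * Num.sqrt E%:R))
       + E%:R * G ^+ 2 / T%:R *
         (4 + (1 - beta) ^+ 2 + 8 * (1 - beta^-1) ^+ 2))%:E)%E.
Proof.
move=> p0 psym pdiag psum ppos beta01 T1 E1 L0 gradE lip Finf gamma wt mg unb ci var nrm.
lazy zeta; set Delta := Fglob p F w0 - finf; set S := \sum_i pw p i ^+ 2.
have p1 : \sum_i pw p i = 1 by exact: psum.
have lip2 i w v : sqnorm (gradF i w - gradF i v) <= L ^+ 2 * sqnorm (w - v).
  have := lip i w v; rewrite -(@ler_pXn2r _ 2) ?nnegrE ?sqrtr_ge0 //; last first.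
    by rewrite mulr_ge0 ?sqrtr_ge0 ?ltW.
  by rewrite exprMn !sqr_sqrtr ?sqnorm_ge0.
pose q := pw p; pose F' := Fglob p F; pose dG := gradglob p gradF.
have q0 i : 0 <= q i by exact: ltW.
have lipG w v : sqnorm (dG w - dG v) <= L ^+ 2 * sqnorm (w - v).
  rewrite /dG /gradglob -sumrB; under eq_bigr do rewrite -scalerBr.
  apply: le_trans (sqnorm_convex _ q0 p1) _.
  have -> : L ^+ 2 * sqnorm (w - v) = \sum_i q i * (L ^+ 2 * sqnorm (w - v)).
    by rewrite -mulr_suml p1 mul1r.
  apply: ler_sum => i _.
  by rewrite ler_wpM2l ?q0.
have smooth w v : F' (w + v) <= F' w + dotv (dG w) v + L / 2 * sqnorm v.
  have -> : L / 2 * sqnorm v = \sum_i q i * (L / 2 * sqnorm v).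
    by rewrite -mulr_suml p1 mul1r.
  rewrite /dG /gradglob dotv_suml -!big_split /=.
  apply: ler_sum => i _.
  rewrite dotvC dotvZr dotvC -!mulrDr ler_wpM2l ?q0 //.
  exact: smooth_descent.
have F'c : continuous F'.
  apply: (@continuous_big _ _ +%R 0 xpredT (@add_continuous _)) => i _ w.
  have [Fd _] := gradE i w.
  apply: (@cvgM _ _ (nbhs w) _ (fun=> pw p i) (F i) (pw p i) (F i w)).
    exact: cvg_cst.
  exact: (differentiable_continuous Fd).
have x0 : 0 < Num.sqrt T%:R :> R by rewrite sqrtr_gt0 ltr0n.
have y0 : 0 < Num.sqrt E%:R :> R by rewrite sqrtr_gt0 ltr0n.
have xx : (Num.sqrt T%:R) ^+ 2 = T%:R :> R by rewrite sqr_sqrtr ?ler0n.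
have yy : (Num.sqrt E%:R) ^+ 2 = E%:R :> R by rewrite sqr_sqrtr ?ler0n.
have gammaE : gamma = (2 * L * (Num.sqrt T%:R * Num.sqrt E%:R))^-1.
  by rewrite /gamma natrM sqrtrM ?ler0n.
have g0 : 0 < gamma by rewrite gammaE invr_gt0 !mulr_gt0.
have Lg : L * gamma <= 1.
  have -> : L * gamma = (2 * (Num.sqrt T%:R * Num.sqrt E%:R))^-1.
    by rewrite gammaE; field; rewrite !gt_eqF.
  have x1 : 1 <= Num.sqrt T%:R :> R.
    by rewrite -(@ler_pXn2r _ 2) ?nnegrE ?(ltW x0) // expr1n xx ler1n.
  have y1 : 1 <= Num.sqrt E%:R :> R.
    by rewrite -(@ler_pXn2r _ 2) ?nnegrE ?(ltW y0) // expr1n yy ler1n.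
  have xy1 : 1 <= Num.sqrt T%:R * Num.sqrt E%:R :> R by rewrite mulr_ege1.
  by rewrite invf_le1 ?mulr_gt0 //; lra.
have sg i t k : (t < T)%N -> (k < E)%N -> vsqint P (g i t k).
  by move=> tT kE; apply: vsqint_bounded (nrm i t k tT kE) => c; exact: mg.
have mG i t k : (t < T)%N -> (k < E)%N -> msq_le P (g i t k) (G ^+ 2).
  move=> tT kE; have s := sg i t k tT kE; split=> //.
  by rewrite -lee_fin (EFin_Rintegral (rint_sqnorm s)); exact: nrm.
pose W t k w := wbar p gamma E w0 (fun j s l => g j s l w) t k.
have sW t k : (t < T)%N -> (k <= E)%N -> vsqint P (W t k).
  move=> tT kE.
  rewrite /W; apply: (closed_wbar p gamma w0 (Q := vsqint P (D := D)) (@vsqint_cst _ _ _ P D) (@vsqintD _ _ _ P D) (@vsqintZ _ _ _ P D)).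
    by move=> i s l st lE; apply: sg => //; exact: ltn_trans tT.
  by move=> i l lk; apply: sg => //; exact: leq_trans kE.
have swt i t k : (t < T)%N -> (k < E)%N -> vsqint P (fun w => wt w i t k).
  move=> tT kE.
  rewrite /wt; apply: (closed_wtil p beta gamma w0 (Q := vsqint P (D := D)) (@vsqint_cst _ _ _ P D) (@vsqintD _ _ _ P D) (@vsqintZ _ _ _ P D)).
    by move=> j s l st lE; apply: sg => //; exact: ltn_trans tT.
  by move=> l lk; apply: sg => //; exact: ltn_trans kE.
(* The averaged iterate at [(t, k)] involves only gradients with lexicographically smaller index. *)
have HW t k : (t < T)%N -> (k < E)%N -> vmeasurable_wrt (mpast g t k) (W t k).
  move=> tT kE; have sH := sigma_algebra_mpast g t k.
  rewrite /W; apply: (closed_wbar p gamma w0 (Q := vmeasurable_wrt (mpast g t k) (D := D)) (vmeasurable_wrt_cst sH (D := D)) (vmeasurable_wrtD sH (D := D))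
    (vmeasurable_wrtZ sH (D := D))).
    move=> i s l st lE; apply: mpast_grad; first by rewrite /lexlt st.
    by move=> c; apply: mg => //; exact: ltn_trans tT.
  move=> i l lk; apply: mpast_grad; first by rewrite /lexlt eqxx lk orbT.
  by move=> c; apply: mg => //; exact: ltn_trans kE.
have mF t k : (t < T)%N -> (k <= E)%N -> measurable_fun setT (fun w => F' (W t k w)).
  move=> tT kE; apply: measurable_fun_continuous_rV => // c.
  by have [] := sW t k tT kE c.
(* [L ^+ 2] times the drift bound; for the prescribed [gamma] this is [4 E G^2 / T]. *)
pose delta := L ^+ 2 * (16 * gamma ^+ 2 * (E%:R ^+ 2 * G ^+ 2)).
pose K := gamma / 2 * delta + L * gamma ^+ 2 / 2 * (S * sigma ^+ 2).
pose a t k := \int[P]_w F' (W t k w).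
pose e t k := \int[P]_w sqnorm (dG (W t k w)).
(* Integrability of the objective is carried along with the inequality, since each step presupposes
   it at the preceding iterate. *)
have step t k : (t < T)%N -> (k < E)%N -> rint P (fun w => F' (W t k w)) ->
    rint P (fun w => F' (W t k.+1 w)) /\
    a t k.+1 <= a t k - gamma / 2 * e t k + K.
  move=> tT kE iF.
  pose h i w := gradF i (wt w i t k).
  have sh i : vsqint P (h i) by apply: (vsqint_lip (lip2 i)); exact: swt.
  have sgk i := sg i t k tT kE.
  have sG : vsqint P (fun w => dG (W t k w)).
    by apply: (vsqint_lip lipG); apply: sW => //; exact: ltnW.
  pose H := mpast g t k.
  have HM : H `<=` d.-measurable by move=> A [].
  have ce i c : is_cond_exp P H (fun w => g i t k w ord0 c) (fun w => h i w ord0 c).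
    by apply: mpast_cond_exp; exact: unb.
  have Hh i c : measurable_wrt H (fun w => h i w ord0 c) by have [] := ce i c.
  have HdG c : measurable_wrt H (fun w => dG (W t k w) ord0 c).
    apply: (vmeasurable_wrt_continuous (sigma_algebra_mpast g t k)
      (f := fun v => dG v ord0 c)); first exact: (lip_continuous lipG).
    exact: HW.
  have WE w : W t k.+1 w = W t k w - gamma *: \sum_i q i *: g i t k w.
    by rewrite /W (wbar_S _ _ _ p1).
  have mF' : measurable_fun setT
      (fun w => F' (W t k w - gamma *: \sum_i q i *: g i t k w)).
    by have := mF t k.+1 tT kE; congr measurable_fun; apply/funext => w; rewrite WE.
  have o1 i c : \int[P]_w (g i t k w ord0 c * dG (W t k w) ord0 c) =
      \int[P]_w (h i w ord0 c * dG (W t k w) ord0 c).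
    apply: (cond_exp_pull HM (ce i c) (HdG c)).
      exact: (sqint_mul (sgk i c) (sG c)).
    exact: (sqint_mul (sh i c) (sG c)).
  (* [h i] is known from the past, so it is orthogonal to the noise of every client [j], including
     [i] itself. *)
  have o2 i j c : \int[P]_w (h i w ord0 c * (g j t k w ord0 c - h j w ord0 c)) = 0.
    under eq_Rintegral do rewrite mulrC mulrBl.
    have i1 := sqint_mul (sgk j c) (sh i c); have i2 := sqint_mul (sh j c) (sh i c).
    by rewrite RintegralB // (cond_exp_pull HM (ce j c) (Hh i c)) ?subrr.
  have o3 i j c : i != j -> \int[P]_w ((g i t k w ord0 c - h i w ord0 c) *
      (g j t k w ord0 c - h j w ord0 c)) = 0.
    move=> ij; apply: (cond_uncorrelated_mul0 HM _ (sgk i c) (sgk j c) (sh i c) (sh j c)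
      (ce i c) (ce j c)).
    apply: (@cond_indep_uncorrelated _ _ _ P H (mpastT g t k) HM C D
      (fun i => g i t k) i j c) => // [k' c'|]; first exact: mg.
    by apply: (mpast_cond_indep (P := P)); exact: ci.
  have var' i : \int[P]_w sqnorm (g i t k w - h i w) <= sigma ^+ 2.
    rewrite -lee_fin EFin_Rintegral; first exact: var.
    by apply: rint_sqnorm; exact: vsqintB.
  have dist i : msq_le P (fun w => gradF i (W t k w) - h i w) delta.
    have [sd dd] := msq_le_drift gamma w0 p0 p1 ppos beta01 i (ltnW kE)
      (fun j s l st lE => mG j s l (leq_ltn_trans st tT) lE) (sqr_ge0 G).
    have sdF : vsqint P (fun w => gradF i (W t k w) - h i w).
      apply: vsqintB => //; apply: (vsqint_lip (lip2 i)).
      by apply: sW => //; exact: ltnW.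
    split=> //.
    apply: (@le_trans _ _ (\int[P]_w (L ^+ 2 * sqnorm (W t k w - wt w i t k)))).
      apply: le_Rintegral => //; first exact: rint_sqnorm.
        by apply: rintZ; exact: rint_sqnorm.
      by move=> w _; exact: lip2.
    rewrite RintegralZl //; last exact: rint_sqnorm.
    by rewrite ler_wpM2l ?sqr_ge0.
  have [iF' le'] := expected_descent q0 p1 L0 (ltW g0) Lg smooth Finf sG sh sgk o1 o2 o3
    var' dist iF mF'.
  have WE' : (fun w => F' (W t k.+1 w)) =
      (fun w => F' (W t k w - gamma *: \sum_i q i *: g i t k w)).
    by apply/funext => w; rewrite WE.
  by rewrite /a WE'; split=> //; rewrite /K addrA.
have base t : (t < T)%N -> rint P (fun w => F' (W t 0%N w)) ->
    forall k, (k <= E)%N -> rint P (fun w => F' (W t k w)).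
  move=> tT i0; elim=> [//|k ih] kE.
  by have [] := step t k tT kE (ih (ltnW kE)).
have Wround t : W t E = W t.+1 0%N.
  by apply/funext => w; rewrite /W (wbar_0 _ _ _ p1) wbar_round.
(* Induction over rounds, starting from the deterministic [w0] and handing over through
   [W t E = W t.+1 0]. *)
have iF t k : (t < T)%N -> (k <= E)%N -> rint P (fun w => F' (W t k w)).
  move=> tT; move: k; apply: (base t tT).
  elim: t tT => [|t ih] tT.
    rewrite (_ : (fun w => _) = fun=> F' w0); first exact: rint_cst.
    by apply/funext => w; rewrite /W (wbar_0 _ _ _ p1).
  by rewrite -Wround; apply: (base t (ltnW tT)) => //; exact: ih (ltnW tT).
have total : \sum_(t < T) \sum_(k < E) e t k <=
    2 / gamma * (Delta + (T * E)%:R * K).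
  have g20 : 0 < gamma / 2 by rewrite divr_gt0.
  rewrite -(ler_pM2l g20) mulrA (_ : gamma / 2 * (2 / gamma) = 1) ?mul1r; last first.
    by field; rewrite gt_eqF.
  have -> : Delta = a 0%N 0%N - finf.
    rewrite /a /Delta (_ : (fun w => _) = fun=> F' w0) ?Rintegral_probability_cst //.
    by apply/funext => w; rewrite /W (wbar_0 _ _ _ p1).
  (* Integrability is available only for rounds below [T], so the last iterate is read as the end of
     round [T.-1]. *)
  have aT : finf <= a T 0%N.
    have -> : a T 0%N = a T.-1 E by rewrite /a Wround prednK.
    rewrite -(Rintegral_probability_cst P finf); apply: le_Rintegral => //.
      exact: rint_cst.
    by apply: iF => //; rewrite prednK.
  have aE t : a t E = a t.+1 0%N by rewrite /a Wround.
  apply: (@le_trans _ _ (\sum_(t < T) \sum_(k < E) (a t k - a t k.+1 + K))).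
    rewrite mulr_sumr; apply: ler_sum => t _; rewrite mulr_sumr; apply: ler_sum => k _.
    have [_ h] := step t k (ltn_ord t) (ltn_ord k) (iF t k (ltn_ord t) (ltnW (ltn_ord k))).
    rewrite -subr_ge0 (_ : _ - _ = a t k - gamma / 2 * e t k + K - a t k.+1).
      by rewrite subr_ge0.
    by rewrite addrAC (addrAC (a t k)) [RHS]addrAC.
  under eq_bigr do rewrite big_split sumr_const card_ord /=.
  rewrite big_split sumr_const card_ord /= (sum_telescope2 _ aE).
  by rewrite -mulrnA mulnC -[K *+ _]mulr_natl lerD2r lerD2l lerN2.
have iE t k : (t < T)%N -> (k < E)%N ->
    (\int[P]_w (sqnorm (dG (W t k w)))%:E = (e t k)%:E)%E.
  move=> tT kE; rewrite EFin_Rintegral //; apply: rint_sqnorm.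
  by apply: (vsqint_lip lipG); apply: sW => //; exact: ltnW.
under eq_bigr => t _ do under eq_bigr => k _ do rewrite (iE t k (ltn_ord t) (ltn_ord k)).
under eq_bigr do rewrite sumEFin.
rewrite sumEFin -EFinM lee_fin.
have N0 : 0 < (T * E)%:R :> R by rewrite ltr0n muln_gt0 T1.
apply: le_trans (ler_wpM2l _ total) _; first by rewrite invr_ge0 ltW.
rewrite /K /delta natrM gammaE; move: x0 y0 xx yy.
set x := Num.sqrt T%:R; set y := Num.sqrt E%:R => x0 y0 <- <-.
(* [Z] collects the nonnegative terms in [beta]. The remaining terms match exactly: [Delta] gets the
   factor [4 L / (x y)], the noise gives [S sigma^2 / (2 x y)] and [delta] gives
   [4 y^2 G^2 / x^2]. *)
pose Z := y ^+ 2 * G ^+ 2 / x ^+ 2 * ((1 - beta) ^+ 2 + 8 * (1 - beta^-1) ^+ 2).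
have Z0 : 0 <= Z.
  apply: mulr_ge0; first by rewrite divr_ge0 ?sqr_ge0 // mulr_ge0 ?sqr_ge0.
  by rewrite addr_ge0 ?sqr_ge0 // mulr_ge0 ?sqr_ge0.
rewrite -[4 + _ + _]addrA [X in _ <= _ + X]mulrDr -/Z [leRHS]addrA -[leLHS]addr0 lerD //.
rewrite le_eqVlt; apply/orP; left; apply/eqP.
by field; rewrite !gt_eqF.
Qed.
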